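(* Let $U^{p|\mathbf{q}}$ and $V^{r|\mathbf{s}}$ be $\mathbb{Z}_2^n$-superdomains with coordinates $(u^a)$ and $(v^b)$ respectively (each system comprising all coordinates, of zero and nonzero degree), and let $\psi: U^{p|\mathbf{q}}\to V^{r|\mathbf{s}}$ be a morphism of $\mathbb{Z}_2^n$-supermanifolds. Then for every $f\in\mathcal{O}(V^{r|\mathbf{s}})$ and every index $a$, $$\frac{\partial \psi^*(f)}{\partial u^a}=\sum_b \frac{\partial \psi^*(v^b)}{\partial u^a}\;\psi^*\!\left(\frac{\partial f}{\partial v^b}\right).$$
   Context: $\mathbb{Z}_2^n=(\mathbb{Z}/2)^n$ with scalar product $\langle\alpha,\beta\rangle=\sum_k\alpha_k\beta_k$. A $\mathbb{Z}_2^n$-graded real associative unital algebra is $\mathbb{Z}_2^n$-commutative if $ab=(-1)^{\langle\deg a,\deg b\rangle}ba$ for homogeneous $a,b$. Let $\gamma_1,\dots,\gamma_N$, $N=2^n-1$, be the nonzero elements of $\mathbb{Z}_2^n$ in a fixed order. For $p\ge 0$ and a tuple $\mathbf{q}=(q_1,\dots,q_N)$ of nonnegative integers, a $\mathbb{Z}_2^n$-superdomain of dimension $p|\mathbf{q}$ is an open subset $U\subset\mathbb{R}^p$ with the sheaf $\mathcal{O}: V\mapsto C^\infty(V)[[\xi]]$ of formal power series $\sum_\alpha f_\alpha(x)\xi^\alpha$ with smooth coefficients in $|\mathbf{q}|=\sum q_i$ variables $\xi$, $q_i$ of them of degree $\gamma_i$, commuting among themselves by the sign rule $\xi^a\xi^b=(-1)^{\langle\deg\xi^a,\deg\xi^b\rangle}\xi^b\xi^a$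 (so variables $\xi$ with $\langle\deg\xi,\deg\xi\rangle$ odd square to zero) and with functions of $x$ having degree $0$. A morphism is a pair consisting of a continuous map of base spaces and a sheaf morphism $\psi^*$ (pullback) of degree-preserving unital algebra morphisms. For coordinates $u=(u^a)=(x,\xi)$, $\partial/\partial u^a$ denotes the coordinate (left) graded derivation, of degree $\deg(u^a)$, with $\partial u^b/\partial u^a=\delta^b_a$; a homogeneous graded derivation $D$ satisfies $D(fg)=Df\cdot g+(-1)^{\langle\deg D,\deg f\rangle}f\cdot Dg$. *)

(* Defs.v *)
From HB Require Import structures.
From mathcomp Require Import all_boot all_order all_algebra.
From mathcomp Require Import all_classical all_reals topology normedtype derive.

Set Implicit Arguments.
Unset Strict Implicit.
Unset Printing Implicit Defensive.

Import Order.TTheory GRing.Theory Num.Theory.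
Import numFieldNormedType.Exports.

Local Open Scope classical_set_scope.
Local Open Scope ring_scope.

Record opens (T : topologicalType) := Opens {
  oset :> set T;
  oset_open : open oset }.

Section SmoothFunctions.
Variables (R : realType) (p : nat).
Implicit Types (f g : 'rV[R]_p -> R) (A : set 'rV[R]_p).

(* Iterated partial derivatives, the head of the list being applied last. *)
Fixpoint iter_partial (s : seq 'I_p) f : 'rV[R]_p -> R :=
  if s is i :: s' then 'D_(delta_mx 0 i) (iter_partial s' f) else f.

Definition smooth_on A f : Prop :=
  forall (s : seq 'I_p) (x : 'rV[R]_p), A x ->
    {for x, continuous (iter_partial s f)} /\
    forall i, derivable (iter_partial s f) x (delta_mx 0 i).

Lemma iter_partial_rcons s i f :
  iter_partial (rcons s i) f = iter_partial s ('D_(delta_mx 0 i) f).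
Proof. by elim: s => //= j s ->. Qed.

Lemma open_near_eq A f g x : open A -> {in A, f =1 g} -> A x ->
  {near x, f =1 g}.
Proof.
move=> oA fg Ax; have : \forall y \near x, A y by exact: open_nbhs_nbhs.
by apply: filterS => y Ay; apply: fg; rewrite inE.
Qed.

Lemma iter_partial_eq A f g s : open A -> {in A, f =1 g} ->
  {in A, iter_partial s f =1 iter_partial s g}.
Proof.
move=> oA fg; elim: s => //= i s IH x; rewrite inE => Ax.
by apply: near_eq_derive; exact: open_near_eq oA IH Ax.
Qed.

Lemma near_eq_continuous f g x : {near x, f =1 g} ->
  {for x, continuous f} -> {for x, continuous g}.
Proof.
move=> fg.
have fgx : f x = g x by exact: nbhs_singleton fg.
by move=> cf; rewrite /prop_for /continuous_at -fgx;
  apply: cvg_trans cf; exact: near_eq_cvg fg.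
Qed.

Lemma smooth_on_eq A f g : open A -> {in A, f =1 g} ->
  smooth_on A f -> smooth_on A g.
Proof.
move=> oA fg sf s x Ax.
have fgs := open_near_eq oA (iter_partial_eq s oA fg) Ax.
have [cf df] := sf s x Ax; split; last first.
  by move=> i; exact: near_eq_derivable fgs (df i).
exact: near_eq_continuous fgs cf.
Qed.

Lemma smooth_onW A B f : B `<=` A -> smooth_on A f -> smooth_on B f.
Proof. by move=> BA sf s x /BA Ax; exact: sf. Qed.

Lemma smooth_on_partial A f i :
  smooth_on A f -> smooth_on A ('D_(delta_mx 0 i) f).
Proof. by move=> sf s; rewrite -iter_partial_rcons; exact: sf. Qed.

Lemma smooth_onS A f :
  (forall x, A x -> {for x, continuous f} /\
     forall i, derivable f x (delta_mx 0 i)) ->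
  (forall i, smooth_on A ('D_(delta_mx 0 i) f)) -> smooth_on A f.
Proof.
move=> f0 fS s; elim/last_ind: s => [|s i _]; first exact: f0.
by rewrite iter_partial_rcons; exact: fS.
Qed.

Lemma smooth_on_ind A (P : (('rV[R]_p -> R) -> Prop)) : open A ->
  (forall f, P f -> (forall x, A x -> {for x, continuous f} /\
      forall i, derivable f x (delta_mx 0 i)) /\
    forall i, exists2 g, P g & {in A, 'D_(delta_mx 0 i) f =1 g}) ->
  forall f, P f -> smooth_on A f.
Proof.
move=> oA Pstep f Pf s; elim/last_ind: s f Pf => [|s i IH] f Pf.
  by have [] := Pstep f Pf.
rewrite iter_partial_rcons => x Ax.
have [_ /(_ i)[g Pg fg]] := Pstep f Pf.
have fgs := open_near_eq oA (iter_partial_eq s oA fg) Ax.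
have gfs : {near x, iter_partial s g =1 iter_partial s ('D_(delta_mx 0 i) f)}.
  by apply: filterS fgs => y.
have [cg dg] := IH g Pg x Ax; split; last first.
  by move=> j; exact: near_eq_derivable gfs (dg j).
exact: near_eq_continuous gfs cg.
Qed.

Inductive smalg A : ('rV[R]_p -> R) -> Prop :=
  | smalg_base f : smooth_on A f -> smalg A f
  | smalg_add f g : smalg A f -> smalg A g -> smalg A (f + g)
  | smalg_mul f g : smalg A f -> smalg A g -> smalg A (f * g).

Lemma smooth_smalg A f : open A -> smalg A f -> smooth_on A f.
Proof.
move=> oA; apply: (smooth_on_ind oA) => {}f; elim=> {f}.
- move=> f sf; split=> [x Ax|i]; first exact: (sf [::]).
  exists ('D_(delta_mx 0 i) f) => //.
  exact/smalg_base/smooth_on_partial.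
- move=> f g sf [f0 fS] sg [g0 gS]; split=> [x Ax|i].
    have [[cf df] [cg dg]] := (f0 x Ax, g0 x Ax).
    by split=> [|i]; [exact: continuousD | exact: derivableD].
  have [[f' Pf' ff'] [g' Pg' gg']] := (fS i, gS i).
  exists (f' + g'); first exact: smalg_add.
  move=> x; rewrite inE => Ax; have [[_ df] [_ dg]] := (f0 x Ax, g0 x Ax).
  by rewrite deriveD// ff' ?gg' ?inE.
- move=> f g sf [f0 fS] sg [g0 gS]; split=> [x Ax|i].
    have [[cf df] [cg dg]] := (f0 x Ax, g0 x Ax).
    by split=> [|i]; [exact: continuousM | exact: derivableM].
  have [[f' Pf' ff'] [g' Pg' gg']] := (fS i, gS i).
  exists (f * g' + g * f').
    by apply: smalg_add; exact: smalg_mul.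
  move=> x; rewrite inE => Ax; have [[_ df] [_ dg]] := (f0 x Ax, g0 x Ax).
  by rewrite deriveM// ff' ?gg' ?inE.
Qed.

Lemma smooth_onD A f g : open A -> smooth_on A f -> smooth_on A g ->
  smooth_on A (f + g).
Proof.
by move=> oA sf sg; apply: smooth_smalg oA _; apply: smalg_add; exact: smalg_base.
Qed.

Lemma smooth_onM A f g : open A -> smooth_on A f -> smooth_on A g ->
  smooth_on A (f * g).
Proof.
by move=> oA sf sg; apply: smooth_smalg oA _; apply: smalg_mul; exact: smalg_base.
Qed.

Lemma smooth_on_cst A (c : R) : smooth_on A (cst c).
Proof.
move=> s x _; suff [d ->] : exists d, iter_partial s (cst c) = cst d.
  by split=> [|i]; [exact: cst_continuous | exact: derivable_cst].
elim: s => [|i s [d IH]] /=; first by exists c.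
by exists 0; apply/funext => y; rewrite IH derive_cst.
Qed.

Lemma is_derive_proj (i : 'I_p) (y v : 'rV[R]_p) :
  is_derive y v (fun x : 'rV[R]_p => x 0 i) (v 0 i).
Proof.
have hl : linear (fun x : 'rV[R]_p => x 0 i) by move=> k a b; rewrite !mxE.
pose hL := GRing.isLinear.Build _ _ _ _ _ hl.
pose h : {linear 'rV[R]_p -> R} := HB.pack (fun x : 'rV[R]_p => x 0 i) hL.
have ch : continuous h by move=> z; exact: coord_continuous.
have dh : differentiable h y by exact/linear_differentiable.
split; first exact: (diff_derivable dh).
by rewrite -[LHS]/('D_v h y) (deriveE v dh) (diff_lin y ch).
Qed.

Lemma smooth_on_proj A (i : 'I_p) : smooth_on A (fun x : 'rV[R]_p => x 0 i).
Proof.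
apply: smooth_onS => [x Ax|j].
  split=> [|j]; first exact: coord_continuous.
  by have [] := is_derive_proj i x (delta_mx 0 j).
have -> : 'D_(delta_mx 0 j) (fun x : 'rV[R]_p => x 0 i) =
    cst ((delta_mx 0 j : 'rV[R]_p) 0 i).
  by apply/funext => y; rewrite (@derive_val _ _ _ _ _ _ _ (is_derive_proj i y _)).
exact: smooth_on_cst.
Qed.

End SmoothFunctions.

Section SmoothAlgebra.
Variables (R : realType) (p : nat) (W : opens 'rV[R]_p).

(* Smooth functions on the open set W, as total functions that vanish outside W:
   Leibniz equality is then equality of functions on W. *)
Record smooth_fun := SmoothFun {
  smooth_val :> 'rV[R]_p -> R;
  smooth_valP : smooth_on W smooth_val;
  smooth_val_out : forall x, ~ oset W x -> smooth_val x = 0 }.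

Implicit Types f g h : smooth_fun.

Lemma smooth_funP f g : f = g :> (_ -> _) -> f = g.
Proof.
case: f g => [f fs fo] [g gs go] /= fg; case: g / fg gs go => gs go.
by congr SmoothFun; exact: Prop_irrelevance.
Qed.

Lemma patch_smooth (f : 'rV[R]_p -> R) :
  smooth_on W f -> smooth_on W (patch (cst 0) W f).
Proof.
by apply: smooth_on_eq => [|x xW]; [exact: oset_open | rewrite patchT].
Qed.

Lemma patch_out (f : 'rV[R]_p -> R) x : ~ oset W x -> patch (cst 0) W f x = 0.
Proof. by move=> nWx; rewrite patchN// inE notin_setE. Qed.

Definition to_smooth (f : 'rV[R]_p -> R) (fs : smooth_on W f) : smooth_fun :=
  SmoothFun (patch_smooth fs) (patch_out f).

Lemma to_smoothE (f : 'rV[R]_p -> R) fs x : oset W x -> @to_smooth f fs x = f x.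
Proof. by move=> Wx; rewrite /= patchT// inE. Qed.

HB.instance Definition _ := gen_eqMixin smooth_fun.
HB.instance Definition _ := gen_choiceMixin smooth_fun.

Let oW : open W := oset_open W.

Definition smooth_zero : smooth_fun :=
  SmoothFun (smooth_on_cst (A := W) 0) (fun _ _ => erefl).

Fact smooth_add_out f g x : ~ oset W x -> (smooth_val f + smooth_val g) x = 0.
Proof. by move=> Wx; rewrite fctE !smooth_val_out ?addr0. Qed.
Definition smooth_add f g : smooth_fun :=
  SmoothFun (smooth_onD oW (smooth_valP f) (smooth_valP g))
    (@smooth_add_out f g).

Fact smooth_mul_out f g x : ~ oset W x -> (smooth_val f * smooth_val g) x = 0.
Proof. by move=> Wx; rewrite fctE !smooth_val_out ?mulr0. Qed.
Definition smooth_mul f g : smooth_fun :=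
  SmoothFun (smooth_onM oW (smooth_valP f) (smooth_valP g))
    (@smooth_mul_out f g).

Fact smooth_scale_out (c : R) f x : ~ oset W x -> (cst c * smooth_val f) x = 0.
Proof. by move=> Wx; rewrite fctE smooth_val_out ?mulr0. Qed.
Definition smooth_scale (c : R) f : smooth_fun :=
  SmoothFun (smooth_onM oW (smooth_on_cst c) (smooth_valP f))
    (@smooth_scale_out c f).

Definition smooth_one : smooth_fun := to_smooth (smooth_on_cst 1).

Fact smooth_addA : associative smooth_add.
Proof. by move=> f g h; apply: smooth_funP; exact: addrA. Qed.
Fact smooth_addC : commutative smooth_add.
Proof. by move=> f g; apply: smooth_funP; exact: addrC. Qed.
Fact smooth_add0 : left_id smooth_zero smooth_add.
Proof. by move=> f; apply: smooth_funP; exact: add0r. Qed.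
Fact smooth_addN : left_inverse smooth_zero (smooth_scale (-1)) smooth_add.
Proof.
by move=> f; apply: smooth_funP; apply/funext => x; rewrite /= !fctE mulN1r addNr.
Qed.
HB.instance Definition _ :=
  GRing.isZmodule.Build smooth_fun smooth_addA smooth_addC smooth_add0 smooth_addN.

Fact smooth_mulA : associative smooth_mul.
Proof. by move=> f g h; apply: smooth_funP; exact: mulrA. Qed.
Fact smooth_mulC : commutative smooth_mul.
Proof. by move=> f g; apply: smooth_funP; exact: mulrC. Qed.
Fact smooth_mul1 : left_id smooth_one smooth_mul.
Proof.
move=> f; apply: smooth_funP; apply/funext => x.
rewrite -[LHS]/(smooth_one x * f x).
have [Wx|Wx] := pselect (oset W x); first by rewrite /smooth_one to_smoothE// mul1r.
by rewrite !smooth_val_out// mulr0.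
Qed.
Fact smooth_mulDl : left_distributive smooth_mul +%R.
Proof. by move=> f g h; apply: smooth_funP; exact: mulrDl. Qed.
HB.instance Definition _ := GRing.Zmodule_isComPzRing.Build smooth_fun
  smooth_mulA smooth_mulC smooth_mul1 smooth_mulDl.

Fact smooth_scaleA a b f : smooth_scale a (smooth_scale b f) = smooth_scale (a * b) f.
Proof. by apply: smooth_funP; exact: mulrA. Qed.
Fact smooth_scale1 : left_id 1 smooth_scale.
Proof. by move=> f; apply: smooth_funP; apply/funext => x; rewrite /= !fctE mul1r. Qed.
Fact smooth_scaleDr : right_distributive smooth_scale +%R.
Proof. by move=> a f g; apply: smooth_funP; exact: mulrDr. Qed.
Fact smooth_scaleDl f : {morph smooth_scale^~ f : a b / a + b}.
Proof. by move=> a b; apply: smooth_funP; apply/funext => x; rewrite /= !fctE mulrDl. Qed.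
HB.instance Definition _ := GRing.Zmodule_isLmodule.Build R smooth_fun
  smooth_scaleA smooth_scale1 smooth_scaleDr smooth_scaleDl.

Definition smooth_coord (i : 'I_p) : smooth_fun :=
  to_smooth (smooth_on_proj (A := W) i).

Definition smooth_partial (i : 'I_p) f : smooth_fun :=
  to_smooth (smooth_on_partial i (smooth_valP f)).

Fact smooth_partial_is_additive i : zmod_morphism (smooth_partial i).
Proof.
move=> f g; apply: smooth_funP; apply/funext => x.
have [Wx|Wx] := pselect (oset W x); last by rewrite !smooth_val_out.
have [[_ df] [_ dg]] := (smooth_valP f [::] Wx, smooth_valP g [::] Wx).
rewrite to_smoothE//= !fctE !patchT ?inE//.
rewrite -[LHS]/('D_(delta_mx 0 i) (smooth_val f + cst (-1) * smooth_val g) x) deriveD//; last first.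
  exact/derivableM.
by rewrite deriveM// derive_cst scaler0 addr0 -[_ *: _]/(_ * _).
Qed.
HB.instance Definition _ i := GRing.isZmodMorphism.Build smooth_fun smooth_fun
  (smooth_partial i) (smooth_partial_is_additive i).

Lemma smooth_partial_coord i j :
  smooth_partial i (smooth_coord j) = if i == j then 1 else 0.
Proof.
apply: smooth_funP; apply/funext => x.
have [Wx|Wx] := pselect (oset W x); last by rewrite !smooth_val_out.
have eqx : {near x, smooth_coord j =1 (fun x : 'rV[R]_p => x 0 j)}.
  apply: (open_near_eq oW) => // y; rewrite inE => Wy.
  by rewrite /smooth_coord to_smoothE.
rewrite to_smoothE// (near_eq_derive _ eqx).
rewrite (@derive_val _ _ _ _ _ _ _ (is_derive_proj j x _)) mxE eqxx /= eq_sym.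
by case: eqP => _ //; rewrite -[RHS]/(smooth_one x) /smooth_one to_smoothE.
Qed.

Lemma smooth_partialM i f g : smooth_partial i (f * g) =
  smooth_partial i f * g + f * smooth_partial i g.
Proof.
apply: smooth_funP; apply/funext => x.
have [Wx|Wx] := pselect (oset W x); last by rewrite !smooth_val_out.
have [[_ df] [_ dg]] := (smooth_valP f [::] Wx, smooth_valP g [::] Wx).
rewrite to_smoothE//= !fctE !patchT ?inE//.
rewrite -[LHS]/('D_(delta_mx 0 i) (smooth_val f * smooth_val g) x) deriveM//.
by rewrite addrC; congr (_ + _); exact: mulrC.
Qed.

End SmoothAlgebra.

Section SmoothRestriction.
Variables (R : realType) (p : nat) (W W' : opens 'rV[R]_p) (sW : W' `<=` W).

Definition smooth_res (f : smooth_fun W) : smooth_fun W' :=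
  to_smooth (smooth_onW sW (smooth_valP f)).

Lemma smooth_resE f x : oset W' x -> smooth_res f x = f x.
Proof. exact: to_smoothE. Qed.

Fact smooth_res_is_additive : zmod_morphism smooth_res.
Proof.
move=> f g; apply: smooth_funP; apply/funext => x.
have [Wx|Wx] := pselect (oset W' x); last by rewrite !smooth_val_out.
rewrite smooth_resE// -[LHS]/(f x + (-1) * g x) -[RHS]/(_ + (-1) * _).
by rewrite !smooth_resE.
Qed.
HB.instance Definition _ := GRing.isZmodMorphism.Build _ _ smooth_res
  smooth_res_is_additive.

End SmoothRestriction.

Section Signs.
Variable n : nat.
Implicit Types a b : 'rV['F_2]_n.

Definition dotZ2 a b : 'F_2 := \sum_k a 0 k * b 0 k.

Lemma dotZ2Dl a a' b : dotZ2 (a + a') b = dotZ2 a b + dotZ2 a' b.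
Proof. by rewrite -big_split; apply: eq_bigr => k _; rewrite mxE mulrDl. Qed.

Lemma dotZ2C a b : dotZ2 a b = dotZ2 b a.
Proof. by apply: eq_bigr => k _; rewrite mulrC. Qed.

Lemma dotZ2Dr a b b' : dotZ2 a (b + b') = dotZ2 a b + dotZ2 a b'.
Proof. by rewrite dotZ2C dotZ2Dl !(dotZ2C a). Qed.

Lemma dotZ2_sumr (I : Type) (r : seq I) (P : pred I) a (F : I -> 'rV['F_2]_n) m :
  dotZ2 a (\sum_(i <- r | P i) F i *+ m i) =
  \sum_(i <- r | P i) dotZ2 a (F i) *+ m i.
Proof.
have d0 : dotZ2 a 0 = 0 by rewrite /dotZ2 big1// => k _; rewrite mxE mulr0.
rewrite (big_morph (dotZ2 a) (dotZ2Dr a) d0); apply: eq_bigr => i _.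
by elim: (m i) => [|k IH]; rewrite ?mulr0n// !mulrS dotZ2Dr IH.
Qed.

Definition ksign (A : pzRingType) (e : 'F_2) : A := (-1) ^+ e.

Lemma ksign0 A : ksign A 0 = 1. Proof. by []. Qed.
Lemma ksign1 A : ksign A 1 = -1. Proof. by []. Qed.

Lemma F2P (x : 'F_2) : x = 0 \/ x = 1.
Proof. by case: x => [[|[|m]] //= ltm]; [left | right]; exact: val_inj. Qed.

Lemma ksignD A e e' : ksign A (e + e') = ksign A e * ksign A e'.
Proof.
by case: (F2P e) => ->; case: (F2P e') => ->;
  rewrite /ksign ?addr0 ?add0r /= ?mul1r ?mulr1// mulN1r opprK.
Qed.

Lemma addF2 (e : 'F_2) : e + e = 0.
Proof. by case: e => [[|[|m]] //= ltm]; exact: val_inj. Qed.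

Lemma ksign_comm (A : pzRingType) e (x : A) : ksign A e * x = x * ksign A e.
Proof. exact/commr_sym/commrX/commrN1. Qed.

End Signs.

Section PowerSeries.
Variables (n : nat) (X : finType) (deg : X -> 'rV['F_2]_n).

Notation midx := {ffun X -> nat}.
Implicit Types a b c : midx.

(* Exponents of the monomials xi^a: a variable whose degree has odd scalar
   square squares to zero, so that its exponent is at most 1. *)
Definition midx_ok a := [forall x, (dotZ2 (deg x) (deg x) == 1) ==> (a x <= 1)%N].

Definition midx_unit (x : X) : midx := [ffun y => (y == x : nat)].

Definition midx_deg a : 'rV['F_2]_n := \sum_x deg x *+ a x.

(* Monomials are written xi_1^a_1 ... xi_m^a_m in the order of the enumeration
   of X; xi^a xi^b = (-1)^(reorder a b) xi^(a+b), since each factor xi_y of xi^b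
   moves to the left of the factors xi_x of xi^a with x after y. *)
Definition reorder a b : 'F_2 :=
  \sum_x \sum_(y | (enum_rank y < enum_rank x)%N)
    dotZ2 (deg x) (deg y) *+ (a x * b y).

(* Degree of the factors of xi^a that a left derivation in xi_x has to cross. *)
Definition before (x : X) a : 'rV['F_2]_n :=
  \sum_(y | (enum_rank y < enum_rank x)%N) deg y *+ a y.

(* All pairs (a, b) with a + b = c (mem_splits), without repetition
   (splits_uniq). *)
Definition splits c : seq (midx * midx) :=
  [seq ([ffun x => val (t x)], [ffun x => c x - t x]%N)
     | t : {dffun forall x, 'I_(c x).+1}].

Lemma mem_splits c a b : ((a, b) \in splits c) = (a + b == c).
Proof.
rewrite /splits; apply/mapP/eqP => [[t _ [-> ->]]|abc].
  by apply/ffunP => x; rewrite !ffunE addrC; apply: subnK; rewrite -ltnS ltn_ord.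
have ac x : (a x < (c x).+1)%N by rewrite -abc ffunE ltnS leq_addr.
exists [ffun x => Ordinal (ac x)]; rewrite ?mem_enum//; congr pair; apply/ffunP => x.
  by rewrite !ffunE.
by rewrite !ffunE /= -abc ffunE; rewrite addKn.
Qed.

Lemma splits_uniq c : uniq (splits c).
Proof.
rewrite map_inj_uniq ?enum_uniq// => t u [/ffunP tu _].
by apply/ffunP => x; apply: val_inj; have := tu x; rewrite !ffunE.
Qed.

Lemma midx_okl a b : midx_ok (a + b) -> midx_ok a.
Proof.
move=> /forallP ok; apply/forallP => x; apply/implyP => dx.
have := implyP (ok x) dx; rewrite ffunE; exact/leq_trans/leq_addr.
Qed.

Lemma midx_okr a b : midx_ok (a + b) -> midx_ok b.
Proof. by rewrite addrC; exact: midx_okl. Qed.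

Lemma midx_addIr c : injective (fun a => a + c).
Proof.
move=> a b /ffunP abc; apply/ffunP => x; have := abc x; rewrite !ffunE.
exact: addIn.
Qed.

Lemma midx_ok0 : midx_ok 0.
Proof. by apply/forallP => x; rewrite ffunE implybT. Qed.

Lemma midx_ok_unit x : midx_ok (midx_unit x).
Proof. by apply/forallP => y; rewrite ffunE leq_b1 implybT. Qed.

Lemma reorderDl a a' b : reorder (a + a') b = reorder a b + reorder a' b.
Proof.
rewrite -big_split; apply: eq_bigr => x _; rewrite -big_split.
by apply: eq_bigr => y _; rewrite ffunE mulnDl mulrnDr.
Qed.

Lemma reorderDr a b b' : reorder a (b + b') = reorder a b + reorder a b'.
Proof.
rewrite -big_split; apply: eq_bigr => x _; rewrite -big_split.
by apply: eq_bigr => y _; rewrite ffunE mulnDr mulrnDr.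
Qed.

Lemma reorder0l b : reorder 0 b = 0.
Proof. by apply: (addrI (reorder 0 b)); rewrite -reorderDl !addr0. Qed.

Lemma reorder0r a : reorder a 0 = 0.
Proof. by apply: (addrI (reorder a 0)); rewrite -reorderDr !addr0. Qed.

Section SplitSums.
Variable A : nmodType.

Lemma splits_assoc c (G : midx -> midx -> midx -> A) :
  \sum_(s <- splits c) \sum_(t <- splits s.2) G s.1 t.1 t.2 =
  \sum_(s <- splits c) \sum_(t <- splits s.1) G t.1 t.2 s.2.
Proof.
pose GG (u : midx * midx * midx) := G u.1.1 u.1.2 u.2.
transitivity (\sum_(u <- [seq (s.1, t.1, t.2) | s <- splits c, t <- splits s.2]) GG u).
  by rewrite big_allpairs_dep.
transitivity (\sum_(u <- [seq (t.1, t.2, s.2) | s <- splits c, t <- splits s.1]) GG u);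
  last by rewrite big_allpairs_dep.
apply: perm_big; apply: uniq_perm.
- apply: allpairs_uniq_dep => [|s _|]; rewrite ?splits_uniq//.
  move=> u v /allpairsPdep[[a b] [[d e] [_ de ->]]].
  move=> /allpairsPdep[[a' b'] [[d' e'] [_ de' ->]]] /=.
  by move: de de'; rewrite !mem_splits /= => /eqP <- /eqP <- [-> -> ->].
- apply: allpairs_uniq_dep => [|s _|]; rewrite ?splits_uniq//.
  move=> u v /allpairsPdep[[a b] [[d e] [_ de ->]]].
  move=> /allpairsPdep[[a' b'] [[d' e'] [_ de' ->]]] /=.
  by move: de de'; rewrite !mem_splits /= => /eqP <- /eqP <- [-> -> ->].
move=> [[u v] w]; apply/allpairsPdep/allpairsPdep => -[[a b] [[d e] [+ + [-> -> ->]]]];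
  rewrite !mem_splits /= => /eqP <- /eqP <-.
- by exists (a + d, e), (a, d); rewrite !mem_splits addrA !eqxx.
- by exists (d, e + b), (e, b); rewrite !mem_splits addrA !eqxx.
Qed.

Lemma splits_0l c (F : midx -> midx -> A) :
  (forall a b, a != 0 -> F a b = 0) -> \sum_(s <- splits c) F s.1 s.2 = F 0 c.
Proof.
move=> F0; rewrite (bigD1_seq (0, c)) ?splits_uniq ?mem_splits ?add0r//=.
rewrite big_seq_cond big1 ?addr0// => -[a b]; rewrite mem_splits => /andP[/eqP <-].
by case: (eqVneq a 0) => [->|a0 _]; rewrite ?add0r ?eqxx// F0.
Qed.

Lemma splits_0r c (F : midx -> midx -> A) :
  (forall a b, b != 0 -> F a b = 0) -> \sum_(s <- splits c) F s.1 s.2 = F c 0.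
Proof.
move=> F0; rewrite (bigD1_seq (c, 0)) ?splits_uniq ?mem_splits ?addr0//=.
rewrite big_seq_cond big1 ?addr0// => -[a b]; rewrite mem_splits => /andP[/eqP <-].
by case: (eqVneq b 0) => [->|b0 _]; rewrite ?addr0 ?eqxx// F0.
Qed.

Lemma splits_shiftl c x (F : midx -> midx -> A) :
  \sum_(s <- splits (c + midx_unit x) | (0 < s.1 x)%N) F s.1 s.2 =
  \sum_(s <- splits c) F (s.1 + midx_unit x) s.2.
Proof.
rewrite -big_filter.
rewrite -[RHS](big_map (fun s : midx * midx => (s.1 + midx_unit x, s.2)) xpredT
  (fun s => F s.1 s.2)).
apply: perm_big; apply: uniq_perm; first exact/filter_uniq/splits_uniq.
  by rewrite map_inj_uniq ?splits_uniq// => -[a b] [a' b'] [/midx_addIr -> ->].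
move=> [a b]; rewrite mem_filter mem_splits /=; apply/andP/mapP.
  move=> [a0 /eqP abc]; have aE : a = [ffun y => a y - midx_unit x y]%N + midx_unit x.
    apply/ffunP => y; rewrite !ffunE; apply/esym/subnK.
    by case: eqP => [->|].
  exists ([ffun y => a y - midx_unit x y]%N, b); last by rewrite /= -aE.
  by rewrite mem_splits; apply/eqP/(@midx_addIr (midx_unit x)); rewrite addrAC -aE.
move=> [[a' b'] + [-> ->]]; rewrite mem_splits => /eqP <-.
by rewrite !ffunE eqxx addrC; split=> //; rewrite addrAC.
Qed.

Lemma splits_swap c (F : midx -> midx -> A) (P : pred midx) :
  \sum_(s <- splits c | P s.2) F s.1 s.2 = \sum_(s <- splits c | P s.1) F s.2 s.1.
Proof.
rewrite -[RHS](big_map (fun s : midx * midx => (s.2, s.1)) (fun s => P s.2)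
  (fun s => F s.1 s.2)).
apply: perm_big; apply: uniq_perm; first exact: splits_uniq.
  by rewrite map_inj_uniq ?splits_uniq// => -[a b] [a' b'] [-> ->].
move=> [a b]; rewrite mem_splits; apply/idP/mapP => [|[[a' b'] + [-> ->]]].
  by exists (b, a) => //; rewrite mem_splits addrC.
by rewrite mem_splits addrC.
Qed.

Lemma splits_shiftr c x (F : midx -> midx -> A) :
  \sum_(s <- splits (c + midx_unit x) | (0 < s.2 x)%N) F s.1 s.2 =
  \sum_(s <- splits c) F s.1 (s.2 + midx_unit x).
Proof.
rewrite (splits_swap _ F (fun a => 0 < a x)%N) (splits_shiftl c x (fun a b => F b a)).
exact: (splits_swap c (fun a b => F b (a + midx_unit x)) xpredT).
Qed.

End SplitSums.

(* Formal power series in the graded variables X: the coefficients of the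
   monomials that vanish are required to be 0, for uniqueness. *)
Record pseries (A : nmodType) := PSeries {
  coef :> midx -> A;
  coef_ok : forall a, ~~ midx_ok a -> coef a = 0 }.

Lemma pseriesP (A : nmodType) (f g : pseries A) : coef f =1 coef g -> f = g.
Proof.
move=> /funext; case: f g => [f fo] [g go] /= fg; case: g / fg go => go.
by congr PSeries; exact: Prop_irrelevance.
Qed.

HB.instance Definition _ A := gen_eqMixin (pseries A).
HB.instance Definition _ A := gen_choiceMixin (pseries A).

Fact to_series_ok (A : nmodType) (F : midx -> A) a :
  ~~ midx_ok a -> (if midx_ok a then F a else 0) = 0.
Proof. by move=> /negPf ->. Qed.

Definition to_series (A : nmodType) (F : midx -> A) : pseries A :=
  PSeries (to_series_ok F).

Section Additive.
Variable A : zmodType.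
Implicit Types f g : pseries A.

Definition series_zero : pseries A := PSeries (fun _ _ => erefl 0).

Fact series_add_ok f g a : ~~ midx_ok a -> f a + g a = 0.
Proof. by move=> ok; rewrite !coef_ok// addr0. Qed.
Definition series_add f g := PSeries (series_add_ok f g).

Fact series_opp_ok f a : ~~ midx_ok a -> - f a = 0.
Proof. by move=> ok; rewrite !coef_ok// oppr0. Qed.
Definition series_opp f := PSeries (series_opp_ok f).

Fact series_addA : associative series_add.
Proof. by move=> f g h; apply: pseriesP => a; exact: addrA. Qed.
Fact series_addC : commutative series_add.
Proof. by move=> f g; apply: pseriesP => a; exact: addrC. Qed.
Fact series_add0 : left_id series_zero series_add.
Proof. by move=> f; apply: pseriesP => a; exact: add0r. Qed.
Fact series_addN : left_inverse series_zero series_opp series_add.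
Proof. by move=> f; apply: pseriesP => a; exact: addNr. Qed.

HB.instance Definition _ := GRing.isZmodule.Build (pseries A)
  series_addA series_addC series_add0 series_addN.

Lemma coefD f g a : (f + g) a = f a + g a. Proof. by []. Qed.
Lemma coefB f g a : (f - g) a = f a - g a. Proof. by []. Qed.

End Additive.

Section Scaling.
Variables (R : pzRingType) (A : lmodType R).
Implicit Types f g : pseries A.

Fact series_scale_ok (k : R) f a : ~~ midx_ok a -> k *: f a = 0.
Proof. by move=> ok; rewrite !coef_ok// scaler0. Qed.
Definition series_scale k f : pseries A := PSeries (series_scale_ok k f).

Fact series_scaleA k l f : series_scale k (series_scale l f) = series_scale (k * l) f.
Proof. by apply: pseriesP => a; exact: scalerA. Qed.
Fact series_scale1 : left_id 1 series_scale.
Proof. by move=> f; apply: pseriesP => a; exact: scale1r. Qed.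
Fact series_scaleDr : right_distributive series_scale +%R.
Proof. by move=> k f g; apply: pseriesP => a; exact: scalerDr. Qed.
Fact series_scaleDl f : {morph series_scale^~ f : k l / k + l}.
Proof. by move=> k l; apply: pseriesP => a; exact: scalerDl. Qed.

HB.instance Definition _ := GRing.Zmodule_isLmodule.Build R (pseries A)
  series_scaleA series_scale1 series_scaleDr series_scaleDl.

End Scaling.

Section Multiplicative.
Variable A : comPzRingType.
Implicit Types f g h : pseries A.

Definition series_const (u : A) : pseries A :=
  to_series (fun a => if a == 0 then u else 0).

Definition series_mul f g : pseries A :=
  to_series (fun c => \sum_(s <- splits c)
    ksign A (reorder s.1 s.2) * (f s.1 * g s.2)).

Fact series_mulA : associative series_mul.
Proof.
move=> f g h; apply: pseriesP => c /=; case: ifP => // okc.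
transitivity (\sum_(s <- splits c) \sum_(t <- splits s.2)
   ksign A (reorder s.1 t.1 + reorder s.1 t.2 + reorder t.1 t.2) *
     (f s.1 * g t.1 * h t.2)).
  rewrite big_seq_cond [RHS]big_seq_cond; apply: eq_bigr => -[a b].
  rewrite mem_splits => /andP[/eqP abc _] /=.
  rewrite (midx_okr (a := a)) ?abc// !mulr_sumr big_seq_cond [RHS]big_seq_cond.
  apply: eq_bigr => -[d e]; rewrite mem_splits => /andP[/eqP <- _] /=.
  by rewrite !ksignD reorderDr ksignD !mulrA; congr (_ * _ * _); rewrite mulrAC.
rewrite (splits_assoc c (fun a d e => ksign A
   (reorder a d + reorder a e + reorder d e) * (f a * g d * h e))); apply/esym.
rewrite big_seq_cond [RHS]big_seq_cond; apply: eq_bigr => -[a b].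
rewrite mem_splits => /andP[/eqP abc _] /=.
rewrite (midx_okl (b := b)) ?abc// mulr_suml mulr_sumr big_seq_cond [RHS]big_seq_cond.
apply: eq_bigr => -[d e]; rewrite mem_splits => /andP[/eqP <- _] /=.
rewrite !ksignD reorderDl ksignD !mulrA; congr (_ * _ * _ * _).
by rewrite mulrC mulrA.
Qed.

Fact series_mul1 : left_id (series_const 1) series_mul.
Proof.
move=> f; apply: pseriesP => c /=; case: ifP => [okc|/negbT okc]; last by rewrite coef_ok.
rewrite (@splits_0l _ c (fun a b => ksign A (reorder a b) * (series_const 1 a * f b))).
  by rewrite reorder0l /= midx_ok0 eqxx !mul1r.
by move=> a b /negPf a0; rewrite /= a0 if_same mul0r mulr0.
Qed.

Fact series_mulr1 : right_id (series_const 1) series_mul.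
Proof.
move=> f; apply: pseriesP => c /=; case: ifP => [okc|/negbT okc]; last by rewrite coef_ok.
rewrite (@splits_0r _ c (fun a b => ksign A (reorder a b) * (f a * series_const 1 b))).
  by rewrite reorder0r /= midx_ok0 eqxx mul1r mulr1.
by move=> a b /negPf a0; rewrite /= a0 if_same !mulr0.
Qed.

Fact series_mulDl : left_distributive series_mul +%R.
Proof.
move=> f g h; apply: pseriesP => c; rewrite coefD /=; case: ifP => _; rewrite ?addr0//.
by rewrite -big_split; apply: eq_bigr => s _; rewrite /= mulrDl mulrDr.
Qed.

Fact series_mulDr : right_distributive series_mul +%R.
Proof.
move=> f g h; apply: pseriesP => c; rewrite coefD /=; case: ifP => _; rewrite ?addr0//.
by rewrite -big_split; apply: eq_bigr => s _; rewrite /= mulrDr mulrDr.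
Qed.

HB.instance Definition _ := GRing.Zmodule_isPzRing.Build (pseries A)
  series_mulA series_mul1 series_mulr1 series_mulDl series_mulDr.

Lemma coefM f g c : (f * g) c = if midx_ok c then
  \sum_(s <- splits c) ksign A (reorder s.1 s.2) * (f s.1 * g s.2) else 0.
Proof. by []. Qed.

Definition series_gen (x : X) : pseries A :=
  to_series (fun a => if a == midx_unit x then 1 else 0).

Definition homogeneous (d : 'rV['F_2]_n) f : Prop :=
  forall a, midx_deg a <> d -> f a = 0.

Fact series_gen_partial_ok x f a : ~~ midx_ok a ->
  ksign A (dotZ2 (deg x) (before x a)) * f (a + midx_unit x) *+ (a x).+1 = 0.
Proof.
by move=> oka; rewrite coef_ok ?mulr0 ?mul0rn//; apply: contra oka; exact: midx_okl.
Qed.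

(* Left derivative in xi_x, from
   d/dxi_x xi^a = (-1)^<deg xi_x, before x a> a_x xi^(a - 1_x);
   series_gen_partialM is its graded Leibniz rule. *)
Definition series_gen_partial x f : pseries A :=
  PSeries (series_gen_partial_ok x f).

Lemma reorder_unitl x b :
  reorder (midx_unit x) b = dotZ2 (deg x) (before x b).
Proof.
rewrite /reorder (bigD1 x)//= [X in _ + X]big1 ?addr0 => [|y yx].
  by rewrite /before dotZ2_sumr; apply: eq_bigr => y _; rewrite ffunE eqxx mul1n.
by rewrite big1// => z _; rewrite ffunE (negPf yx) mul0n mulr0n.
Qed.

Lemma reorder_unitr x a : dotZ2 (deg x) (midx_deg a) =
  dotZ2 (deg x) (before x a) + reorder a (midx_unit x) +
  dotZ2 (deg x) (deg x) *+ a x.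
Proof.
have -> : reorder a (midx_unit x) =
    \sum_(y | (enum_rank x < enum_rank y)%N) dotZ2 (deg x) (deg y) *+ a y.
  rewrite /reorder [RHS]big_mkcond; apply: eq_bigr => y _; case: ifP => xy.
    rewrite (bigD1 x)//= big1 ?addr0 => [|z /andP[_ zx]].
      by rewrite ffunE eqxx muln1 dotZ2C.
    by rewrite ffunE (negPf zx) muln0 mulr0n.
  rewrite big1// => z zy; rewrite ffunE; case: eqP zy => [->|_ _].
    by rewrite xy.
  by rewrite muln0 mulr0n.
rewrite !dotZ2_sumr (bigD1 x)//= addrC; congr (_ + _).
rewrite (bigID (fun y => enum_rank y < enum_rank x)%N)/=; congr (_ + _).
  apply: eq_bigl => y; rewrite andbC; case: ltnP => //= yx.
  by apply: contraTneq yx => ->; rewrite ltnn.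
apply: eq_bigl => y; rewrite -leqNgt ltn_neqAle andbC (inj_eq val_inj).
by rewrite (inj_eq enum_rank_inj) eq_sym andbC.
Qed.

Lemma beforeD x a b : before x (a + b) = before x a + before x b.
Proof. by rewrite -big_split; apply: eq_bigr => y _; rewrite ffunE mulrnDr. Qed.

Lemma before_unit x : before x (midx_unit x) = 0.
Proof.
apply: big1 => y; rewrite ffunE; case: eqP => [->|_ _]; last by rewrite mulr0n.
by rewrite ltnn.
Qed.

End Multiplicative.

End PowerSeries.

Section GradedDerivation.
Variables (n : nat) (X : finType) (deg : X -> 'rV['F_2]_n).
Variable A : comPzRingType.
Notation midx := {ffun X -> nat}.
Implicit Types (a b c : midx) (f g h : pseries deg A).

Lemma coef_ksign e f a : (ksign (pseries deg A) e * f) a = ksign A e * f a.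
Proof.
by case: (F2P e) => ->; rewrite ?ksign0 ?ksign1 ?mul1r ?mulN1r.
Qed.

Lemma dotZ2_deg a b : dotZ2 (midx_deg deg a) (midx_deg deg b) =
  reorder deg a b + reorder deg b a +
  \sum_x dotZ2 (deg x) (deg x) *+ (a x * b x).
Proof.
have -> : dotZ2 (midx_deg deg a) (midx_deg deg b) =
    \sum_x \sum_y dotZ2 (deg x) (deg y) *+ (a x * b y).
  rewrite dotZ2C dotZ2_sumr; apply: eq_bigr => x _.
  rewrite dotZ2C dotZ2_sumr -sumrMnl; apply: eq_bigr => y _.
  by rewrite -mulrnA mulnC.
have -> : reorder deg b a =
    \sum_x \sum_(y | (enum_rank x < enum_rank y)%N)
      dotZ2 (deg x) (deg y) *+ (a x * b y).
  rewrite /reorder (exchange_big_dep xpredT)//=; apply: eq_bigr => x _.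
  by apply: eq_bigr => y _; rewrite dotZ2C mulnC.
rewrite /reorder -!big_split; apply: eq_bigr => x _.
rewrite (bigD1 x)//= addrC; congr (_ + _).
rewrite (bigID (fun y => enum_rank y < enum_rank x)%N)/=; congr (_ + _).
  apply: eq_bigl => y; rewrite andbC; case: ltnP => //= yx.
  by apply: contraTneq yx => ->; rewrite ltnn.
apply: eq_bigl => y; rewrite -leqNgt ltn_neqAle andbC (inj_eq val_inj).
by rewrite (inj_eq enum_rank_inj) eq_sym andbC.
Qed.

Lemma series_mul_gcomm d e f g : homogeneous d f -> homogeneous e g ->
  f * g = ksign (pseries deg A) (dotZ2 d e) * (g * f).
Proof.
move=> df eg; apply: pseriesP => c; rewrite coef_ksign !coefM.
case: ifP => [okc|_]; last by rewrite mulr0.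
rewrite (splits_swap c (fun a b => ksign A (reorder deg a b) * (f a * g b)) xpredT).
rewrite mulr_sumr big_seq_cond [RHS]big_seq_cond; apply: eq_bigr => -[a b].
rewrite mem_splits => /andP[/eqP abc _] /=.
have [dfb|/df ->] := pselect (midx_deg deg b = d); last by rewrite !(mul0r, mulr0).
have [ega|/eg ->] := pselect (midx_deg deg a = e); last by rewrite !(mul0r, mulr0).
rewrite mulrA (mulrC (f b)) -ksignD -dfb -ega dotZ2_deg big1 ?addr0 => [|x _].
  by rewrite -addrA addF2 addr0.
have := forallP okc x; rewrite -abc ffunE; case: (F2P (dotZ2 (deg x) (deg x))) => ->.
  by rewrite mul0rn.
rewrite eqxx implyTb -[(a x + b x)%R]/(a x + b x)%N.
by case: (a x) (b x) => [|k] [|l]; rewrite ?muln0 ?mul0n ?addSn ?addnS.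
Qed.

Lemma series_gen_homogeneous x : homogeneous (deg x) (series_gen deg A x).
Proof.
move=> a; rewrite /=; case: eqP => [-> []|_ _]; last by rewrite if_same.
rewrite /midx_deg (bigD1 x)//= big1 ?addr0 => [|y /negPf yx].
  by rewrite ffunE eqxx.
by rewrite ffunE yx.
Qed.

Lemma series_gen_partialM x d f g : homogeneous d f ->
  series_gen_partial x (f * g) = series_gen_partial x f * g +
    ksign (pseries deg A) (dotZ2 (deg x) d) * (f * series_gen_partial x g).
Proof.
move=> df; apply: pseriesP => c; rewrite coefD coef_ksign !coefM /=.
case: (boolP (midx_ok deg c)) => okc; last first.
  rewrite (negPf (contra (@midx_okl _ _ _ _ _) okc)).
  by rewrite mulr0 mul0rn mulr0 addr0.
pose e := midx_unit x; pose s a := dotZ2 (deg x) (before deg x a).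
pose K a b := ksign A (s (a + b) + reorder deg a b) * (f a * g b).
have sD a b : s (a + b) = s a + s b by rewrite /s beforeD dotZ2Dr.
have se : s e = 0.
  by rewrite /s before_unit; apply: (addrI (dotZ2 (deg x) 0)); rewrite -dotZ2Dr !addr0.
have ex a : (a + e) x = (a x).+1 by rewrite !ffunE eqxx addrC.
transitivity (\sum_(t <- splits (c + e)) K t.1 t.2 *+ t.1 x +
    \sum_(t <- splits (c + e))
      ksign A (dotZ2 (deg x) (deg x) *+ t.1 x) * K t.1 t.2 *+ t.2 x); last first.
  congr (_ + _).
    rewrite (bigID (fun t : midx * midx => 0 < t.1 x)%N)/= [X in _ + X]big1 ?addr0; last first.
      by move=> t; rewrite -eqn0Ngt => /eqP ->.
    rewrite (splits_shiftl c x (fun a b => K a b *+ a x)); apply: eq_bigr => -[a b] _ /=.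
    rewrite -/e ex.
    rewrite mulrnAl mulrnAr; congr (_ *+ _).
    rewrite /K !mulrA -ksignD; congr (ksign A _ * _ * _).
    rewrite reorderDl reorder_unitl -/(s b) !sD se addr0.
    by rewrite addrACA -addrA [s b + s b]addF2 addr0 addrC.
  rewrite (bigID (fun t : midx * midx => 0 < t.2 x)%N)/= [X in _ + X]big1 ?addr0; last first.
    by move=> t; rewrite -eqn0Ngt => /eqP ->; rewrite mulr0n.
  rewrite (splits_shiftr c x
    (fun a b => ksign A (dotZ2 (deg x) (deg x) *+ a x) * K a b *+ b x)).
  rewrite mulr_sumr; apply: eq_bigr => -[a b] _ /=.
  rewrite -/e ex.
  rewrite !mulrnAr; congr (_ *+ _).
  have [dfa|/df fa0] := pselect (midx_deg deg a = d); last first.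
    by rewrite /K fa0 !(mul0r, mulr0).
  rewrite /K [f a * (_ * _)]mulrCA !mulrA -!ksignD; congr (ksign A _ * _ * _).
  rewrite -dfa (reorder_unitr deg x a) reorderDr !sD se addr0 -/(s a).
  set u := reorder deg a e; set v := _ *+ _; set w := reorder deg a b.
  by rewrite -/(s b) [LHS](AC (1*(2*2)) (2*5*1*4*3)).
rewrite -big_split /= -/e.
have nok b : dotZ2 (deg x) (deg x) = 1 -> (1 < b x)%N -> ~~ midx_ok deg b.
  by move=> dx bx; apply/forallPn; exists x; rewrite dx eqxx -ltnNge.
case: (boolP (midx_ok deg (c + e))) => [okce|/forallPn[y]]; last first.
  rewrite negb_imply => /andP[/eqP dy cey].
  have yx : y = x.
    apply: contraNeq cey => /negPf yx; rewrite !ffunE yx addr0.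
    by have := implyP (forallP okc y); rewrite dy eqxx; exact.
  move: cey dy; rewrite {}yx ex => cx1 dx.
  have cx : c x = 1%N.
    apply/eqP; rewrite eqn_leq (implyP (forallP okc x)) ?dx ?eqxx//.
    by rewrite ltnNge; apply: contra cx1 => cx0; rewrite ltnS.
  rewrite mulr0 mul0rn big_seq big1// => -[a b]; rewrite mem_splits => /eqP abce.
  have abx : (a x + b x)%N = 2%N.
    by have := congr1 (fun h : midx => h x) abce; rewrite ex cx ffunE.
  rewrite /= dx; case ax : (a x) abx => [|[|[|k]]]; case bx : (b x) => [|[|[|l]]] // _.
  - by rewrite /K [g b]coef_ok ?nok ?bx// !(mulr0, mul0rn) addr0.
  - by rewrite ksign1 mulN1r !mulr1n addrN.
  - by rewrite /K [f a]coef_ok ?nok ?ax// !(mul0r, mulr0, mul0rn) addr0.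
rewrite mulr_sumr -sumrMnl big_seq [RHS]big_seq; apply: eq_bigr => -[a b].
rewrite mem_splits => /eqP abce /=.
have abx : (a x + b x)%N = (c x).+1.
  by have := congr1 (fun h : midx => h x) abce; rewrite ex ffunE.
have -> : ksign A (dotZ2 (deg x) (deg x) *+ a x) * K a b *+ b x = K a b *+ b x.
  case: (F2P (dotZ2 (deg x) (deg x))) => dx; first by rewrite dx mul0rn mul1r.
  have := implyP (forallP okce x); rewrite dx eqxx ex ltnS leqn0 => /(_ isT)/eqP cx.
  move: abx; rewrite cx; case: (a x) (b x) => [|[|k]] [|[|l]]// _.
  by rewrite mulr0n mul1r.
rewrite -mulrnDr [X in K a b *+ X]abx; congr (_ *+ _).
by rewrite /K abce sD se addr0 ksignD -mulrA.
Qed.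

Lemma series_gen_partial_gen x y :
  series_gen_partial x (series_gen deg A y) = if x == y then 1 else 0.
Proof.
have [<-|xy] := eqVneq x y; apply: pseriesP => c /=; last first.
  case: (c + _ =P _) => [/ffunP/(_ x)|_].
    by rewrite !ffunE eqxx (negPf xy) addrC.
  by rewrite if_same mulr0 mul0rn.
have [->|c0] := eqVneq c 0; last first.
  case: (c + _ =P _) => [cx|_]; last by rewrite !if_same mulr0 mul0rn.
  by case/eqP: c0; apply: (@midx_addIr _ (midx_unit x)); rewrite cx add0r.
have -> : before deg x 0 = 0 by apply: big1 => y' _; rewrite ffunE mulr0n.
have -> : dotZ2 (deg x) 0 = 0 by apply: big1 => k _; rewrite mxE mulr0.
by rewrite add0r midx_ok_unit midx_ok0 eqxx mulr1 ffunE.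
Qed.

End GradedDerivation.

Section SeriesMap.
Variables (n : nat) (X : finType) (deg : X -> 'rV['F_2]_n).

Fact series_map_ok (A B : zmodType) (h : {additive A -> B}) (f : pseries deg A) a :
  ~~ midx_ok deg a -> h (f a) = 0.
Proof. by move=> ok; rewrite coef_ok// raddf0. Qed.

Definition series_map (A B : zmodType) (h : {additive A -> B}) (f : pseries deg A) :
  pseries deg B := PSeries (series_map_ok h f).

Lemma series_mapM (A : comPzRingType) (D : {additive A -> A}) :
  (forall u v, D (u * v) = D u * v + u * D v) ->
  forall f g : pseries deg A,
    series_map D (f * g) = series_map D f * g + f * series_map D g.
Proof.
move=> DM f g; apply: pseriesP => c; rewrite coefD -[LHS]/(D ((f * g) c)) !coefM.
case: ifP => _; last by rewrite raddf0 addr0.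
rewrite raddf_sum -big_split; apply: eq_bigr => s _ /=.
rewrite -mulrDr -DM.
by case: (F2P (reorder deg s.1 s.2)) => ->;
  rewrite ?ksign0 ?ksign1 ?mul1r ?mulN1r ?raddfN.
Qed.

End SeriesMap.

(* A fixed order gamma_1, ..., gamma_N of the nonzero elements of Z_2^n. *)
Record nonzero_order (n : nat) := NonzeroOrder {
  nz_elt :> 'I_(2 ^ n).-1 -> 'rV['F_2]_n;
  nz_elt_inj : injective nz_elt;
  nz_eltP : forall d, d != 0 <-> exists i, nz_elt i = d }.

Lemma nonzero_order_ex (n : nat) : inhabited (nonzero_order n).
Proof.
pose S := [set d : 'rV['F_2]_n | d != 0]%SET.
have cS : (2 ^ n).-1 = #|S|.
  rewrite -[S]/[set d | d != 0]%SET (_ : finset _ = [set~ 0]%SET).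
    by rewrite cardsC1 card_mx card_Fp// mul1n.
  by apply/setP => d; rewrite !finset.inE.
have inS i : @enum_val _ (mem S) (cast_ord cS i) \in S by exact: enum_valP.
constructor; apply: (@NonzeroOrder _ (fun i => enum_val (cast_ord cS i))).
  by move=> i j /enum_val_inj/cast_ord_inj.
move=> d; split=> [d0|[i <-]]; last by have := inS i; rewrite finset.inE.
have dS : d \in S by rewrite finset.inE.
exists (cast_ord (esym cS) (enum_rank_in dS d)).
by rewrite cast_ordKV enum_rankK_in.
Qed.

(* The superdomain U^{p|q}, with p = dim0, q_i = dimq i, and U = body. *)
Record superdomain (R : realType) (n : nat) := Superdomain {
  dim0 : nat;
  dimq : 'I_(2 ^ n).-1 -> nat;
  body :> opens 'rV[R]_dim0 }.

Section Superdomains.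
Variables (R : realType) (n : nat) (gamma : nonzero_order n).
Implicit Types U V : superdomain R n.

Definition xi_index U : finType := {i : 'I_(2 ^ n).-1 & 'I_(dimq U i)}.

Definition xi_deg U (x : xi_index U) : 'rV['F_2]_n := gamma (tag x).

Definition sheaf U (W : opens 'rV[R]_(dim0 U)) : Type :=
  pseries (@xi_deg U) (smooth_fun W).

HB.instance Definition _ U W := GRing.PzRing.on (@sheaf U W).
HB.instance Definition _ U W := GRing.Lmodule.on (@sheaf U W).

Lemma sheaf_scalerAl U (W : opens 'rV[R]_(dim0 U)) (k : R) (f g : sheaf W) :
  k *: (f * g) = (k *: f) * g.
Proof.
have kA (u v : smooth_fun W) : k *: (u * v) = (k *: u) * v.
  by apply: smooth_funP; exact: mulrA.
apply: pseriesP => c; rewrite -[LHS]/(k *: ((f : pseries _ _) * g) c) !coefM.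
case: ifP => _; last by rewrite scaler0.
rewrite scaler_sumr; apply: eq_bigr => s _.
by rewrite mulrC kA mulrC -kA.
Qed.

Definition sheaf_res U (W W' : opens 'rV[R]_(dim0 U)) (sW : W' `<=` W) :
  sheaf W -> sheaf W' := series_map (smooth_res sW).

Definition coord_index U : finType := ('I_(dim0 U) + xi_index U)%type.

Definition coord_deg U (a : coord_index U) : 'rV['F_2]_n :=
  match a with inl _ => 0 | inr x => xi_deg x end.

Definition coordinate U (W : opens 'rV[R]_(dim0 U)) (a : coord_index U) : sheaf W :=
  match a with
  | inl i => series_const (@xi_deg U) (smooth_coord W i)
  | inr x => series_gen (@xi_deg U) (smooth_fun W) x
  end.

Definition pd U (W : opens 'rV[R]_(dim0 U)) (a : coord_index U) (f : sheaf W) :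
    sheaf W :=
  match a with
  | inl i => series_map (smooth_partial i) f
  | inr x => series_gen_partial x f
  end.

Lemma coord_homogeneous U W a :
  homogeneous (coord_deg a) (@coordinate U W a : pseries _ _).
Proof.
case: a => [i|x]; last exact: series_gen_homogeneous.
move=> a; rewrite /=; case: eqP => [-> []|_ _]; last by rewrite if_same.
by apply: big1 => x _; rewrite ffunE mulr0n.
Qed.

Lemma pdM U W a d (f g : @sheaf U W) : homogeneous d f ->
  pd a (f * g) = pd a f * g +
    ksign (sheaf W) (dotZ2 (coord_deg a) d) * (f * pd a g).
Proof.
case: a => [i|x] hf; last exact: series_gen_partialM.
have -> : dotZ2 (coord_deg (inl i : coord_index U)) d = 0.
  by apply: big1 => k _; rewrite mxE mul0r.
rewrite ksign0 mul1r; exact: series_mapM (smooth_partialM i) f g.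
Qed.

Lemma pd_coord U W a b : pd a (@coordinate U W b) = if a == b then 1 else 0.
Proof.
case: a b => [i|x] [j|y].
- have -> : (inl i == inl j :> coord_index U) = (i == j) by [].
  apply: pseriesP => c /=; case: (boolP (midx_ok _ c)) => ok; last first.
    by rewrite raddf0 coef_ok.
  have [->|c0] := eqVneq c 0; last first.
    by rewrite raddf0; case: ifP => _ //=; rewrite (negPf c0) if_same.
  by rewrite smooth_partial_coord; case: ifP => _ //=; rewrite eqxx midx_ok0.
- apply: pseriesP => c /=; case: ifP => _; last by rewrite raddf0.
  case: ifP => _; last by rewrite raddf0.
  have := smooth_partialM i (1 : smooth_fun W) 1.
  by rewrite !mulr1 mul1r -[X in X = _ -> _]addr0 => /addrI/esym.
- apply: pseriesP => c /=; case: ifP => _; last by rewrite mulr0 mul0rn.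
  case: eqP => [/ffunP/(_ x)|_]; last by rewrite mulr0 mul0rn.
  by rewrite !ffunE eqxx addrC.
- exact: series_gen_partial_gen.
Qed.

(* Values of base_fun outside U are irrelevant. *)
Record base_map U V := BaseMap {
  base_fun :> 'rV[R]_(dim0 U) -> 'rV[R]_(dim0 V);
  base_cont : {within U, continuous base_fun};
  base_sub : forall x, oset U x -> oset V (base_fun x) }.

Fact preim_open U V (phi : base_map U V) (W : opens 'rV[R]_(dim0 V)) :
  open (U `&` phi @^-1` W).
Proof.
rewrite openE => x [Ux Wx]; apply: filterI.
  exact: open_nbhs_nbhs (conj (oset_open U) Ux).
have cphi : {in oset U, continuous phi}.
  by rewrite -continuous_open_subspace; [exact: base_cont | exact: oset_open].
by apply: (cphi x); [rewrite inE | exact: open_nbhs_nbhs (conj (oset_open W) Wx)].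
Qed.

Definition preim U V (phi : base_map U V) (W : opens 'rV[R]_(dim0 V)) :
  opens 'rV[R]_(dim0 U) := Opens (@preim_open U V phi W).

Lemma preim_mono U V (phi : base_map U V) (W W' : opens 'rV[R]_(dim0 V)) :
  W' `<=` W -> preim phi W' `<=` preim phi W.
Proof. by move=> sW x [Ux Wx]; split => //; exact: sW. Qed.

Lemma sub_preim U V (phi : base_map U V) : U `<=` preim phi V.
Proof. by move=> x Ux; split => //; exact: base_sub. Qed.

(* A continuous map of the bodies and a morphism from the sheaf of V to the
   direct image of the sheaf of U. Sections on the empty set form the zero ring,
   hence {rmorphism _} and scalable instead of {lrmorphism _}, whose source and
   target have to be nontrivial. *)
Record morphism U V := Morphism {
  base : base_map U V;
  pull : forall W : opens 'rV[R]_(dim0 V), W `<=` V ->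
    {rmorphism sheaf W -> sheaf (preim base W)};
  pull_scale : forall (W : opens 'rV[R]_(dim0 V)) (sW : W `<=` V), scalable (pull sW);
  pull_deg : forall (W : opens 'rV[R]_(dim0 V)) (sW : W `<=` V) d (f : sheaf W),
    homogeneous d f -> homogeneous d (pull sW f);
  pull_res : forall (W W' : opens 'rV[R]_(dim0 V))
      (sW : W `<=` V) (sW' : W' `<=` V) (sWW' : W' `<=` W) (f : sheaf W),
    pull sW' (sheaf_res sWW' f) =
      sheaf_res (preim_mono sWW') (pull sW f) }.

(* Global sections; preim base V and U are the same subset. *)
Definition pullback U V (psi : morphism U V) (f : sheaf V) : sheaf U :=
  sheaf_res (@sub_preim U V (base psi)) (pull psi (@subset_refl _ V) f).

End Superdomains.

(* Main.v *)
Require Import Defs.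
From HB Require Import structures.
From mathcomp Require Import all_boot all_order all_algebra.
From mathcomp Require Import all_classical all_reals topology normedtype derive.
From mathcomp Require Import realfun measure lebesgue_measure lebesgue_integral ftc.
From mathcomp Require Import ring lra.

(** Both sides of the chain rule, as functions of f, are derivations along the
    pullback: writing psi* for the pullback, v^b for the coordinates and a for
    the coordinate differentiated, their difference
      E f = d_a (psi* f) - sum_b d_a (psi* v^b) . psi* (d_b f)
    satisfies E (w g) = (-1)^<deg a, deg v^b> psi*(w) E g as soon as w is a
    coordinate v^b minus a constant, because the terms with a derivative of w
    cancel (chain_defectM).  The point is to deduce E = 0 without knowing what
    psi* does to a smooth function or to an infinite power series.

    Everything commutes with restriction, so fix a point x of the body of U, let
    y be its image in V, and work over a ball W around y.  Three facts conclude.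
    - Hadamard lemma (sheaf_hadamard): every section over W is of the form
        f = c + sum_b (v^b - y^b) g_b
      with c a real number and y^b = 0 for the variables of nonzero degree.  For
      a power series, every nonconstant monomial is divisible by one of its
      variables; this leaves its constant coefficient, to which the Hadamard
      lemma for smooth functions (hadamard) applies.  The quotients in the latter
      are integrals over [0, 1] of a derivative of f along segments, whose
      smoothness rests on differentiation under the integral sign.
    - Locality (pull_shifted_coord): psi* (v^b - y^b) has value 0 at x.  For a
      coordinate of degree 0 this is not part of the definition of a morphism: if
      the pullback of a smooth function u had at x a value c different from u y,
      then u - c would be invertible near y, and its pullback would be both
      invertible near x and of value 0 at x.
    - Separation (vanishes_coef): a section all of whose iterated derivatives in
      all the coordinates have value 0 at x has all its coefficients 0 at x.

    By the Hadamard lemma E f is a sum of terms psi*(v^b - y^b) E g_b up to sign.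
    By locality and the graded Leibniz rule, multiplication by psi*(v^b - y^b)
    increases the order of vanishing at x by one, so that by induction E f
    vanishes at x to every order (chain_defect_vanishes).  Hence E f = 0. *)

Set Implicit Arguments.
Unset Strict Implicit.
Unset Printing Implicit Defensive.

Import Order.TTheory GRing.Theory Num.Theory.
Import numFieldNormedType.Exports.

Local Open Scope classical_set_scope.
Local Open Scope ring_scope.

(** * Derivatives along lines *)

Section Lines.
Variables (R : realType) (p : nat).
Implicit Types (f : 'rV[R]_p -> R) (a v : 'rV[R]_p).

Lemma line_derive f a v s d : is_derive (a + s *: v) v f d ->
  is_derive s 1 (fun r => f (a + r *: v)) d.
Proof.
move=> [df dE].
have E : (fun h : R => h^-1 *: (((fun r => f (a + r *: v)) \o shift s) (h *: 1) -
    (fun r => f (a + r *: v)) s)) =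
   (fun h => h^-1 *: ((f \o shift (a + s *: v)) (h *: v) - f (a + s *: v))).
  apply/funext => h /=; congr (_ *: (f _ - _)).
  by rewrite -[h *: 1]/(h * 1) mulr1 scalerDl addrCA.
split; first by rewrite /derivable E; exact: df.
by rewrite /derive E -dE.
Qed.

Lemma derive_line f a v d : is_derive (0 : R) 1 (fun r => f (a + r *: v)) d ->
  is_derive a v f d.
Proof.
move=> [df dE].
have E : (fun h : R => h^-1 *: (((fun r => f (a + r *: v)) \o shift 0) (h *: 1) -
    (fun r => f (a + r *: v)) 0)) =
   (fun h => h^-1 *: ((f \o shift a) (h *: v) - f a)).
  apply/funext => h /=; rewrite scale0r !addr0.
  by rewrite -[h *: 1]/(h * 1) mulr1 [a + _]addrC.
split; first by rewrite /derivable -E; exact: df.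
by rewrite /derive -E -dE.
Qed.

(** No differentiability of f is needed: the derivative along v determines the one
    along c v. *)
Lemma is_derive_scale f a v (c : R) d :
  is_derive a v f d -> is_derive a (c *: v) f (c * d).
Proof.
move=> df; apply: derive_line.
have df0 : is_derive (c * 0 : R) 1 (fun r => f (a + r *: v)) d.
  by apply: line_derive; rewrite mulr0 scale0r addr0.
have dc : is_derive (0 : R) 1 (fun r : R => c * r) c.
  have := @is_deriveZ R R R id c 0 1 1 (is_derive_id _ _).
  by rewrite -[c *: 1]/(c * 1) mulr1.
rewrite [X in is_derive _ _ X](_ : _ =
    (fun r => f (a + r *: v)) \o (fun r : R => c * r)).
  by apply: is_derive_eq (is_derive1_comp df0 dc) _; rewrite mulrC.
by apply/funext => r /=; rewrite scalerA mulrC.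
Qed.

Lemma MVT_line f a v (s : R) :
  (forall r : R, `|r| <= `|s| -> derivable f (a + r *: v) v) ->
  exists2 r : R, `|r| <= `|s| & f (a + s *: v) - f a = s * 'D_v f (a + r *: v).
Proof.
move=> df.
have dl (r : R) : `|r| <= `|s| ->
      is_derive r 1 (fun r => f (a + r *: v)) ('D_v f (a + r *: v)).
  by move=> /df dfr; apply: line_derive; apply/derivableP.
have cl (r : R) : `|r| <= `|s| -> {for r, continuous (fun r : R => f (a + r *: v))}.
  by move=> /dl[dr _]; apply/differentiable_continuous/derivable1_diffP.
have cw (b c : R) : (forall r, r \in `[b, c] -> `|r| <= `|s|) ->
    {within `[b, c], continuous (fun r : R => f (a + r *: v))}.
  move=> bc; apply: continuous_in_subspaceT => r; rewrite inE => rbc.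
  exact/cl/bc.
pose df' (r : R) := 'D_v f (a + r *: v).
have [s0|s0] := leP 0 s.
  have bnd r : r \in `[0, s] -> `|r| <= `|s|.
    by rewrite in_itv /= => /andP[r0 rs]; rewrite !ger0_norm.
  have [|c cin] := @MVT_segment _ _ df' _ _ s0 _ (cw _ _ bnd).
    by move=> r /subset_itv_oo_cc/bnd; exact: dl.
  rewrite scale0r addr0 subr0 mulrC => E; exists c => //; exact: bnd.
have bnd r : r \in `[s, 0] -> `|r| <= `|s|.
  by rewrite in_itv /= => /andP[r0 rs]; rewrite !ler0_norm ?lerN2 // ltW.
have [|c cin] := @MVT_segment _ _ df' _ _ (ltW s0) _ (cw _ _ bnd).
  by move=> r /subset_itv_oo_cc/bnd; exact: dl.
rewrite scale0r addr0 sub0r => E; exists c; first exact: bnd.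
by rewrite -opprB E mulrN opprK mulrC.
Qed.

End Lines.

(** * Integrals over the unit interval depending on a parameter *)

Section UnitIntegral.
Variable R : realType.
Implicit Types u v : R -> R.

(** The integral of u over [0, 1]. *)
Definition unit_int u : R := Rintegral (@lebesgue_measure R) `[0, 1] u.

(** Continuity at all points of [0, 1], from both sides also at 0 and 1. *)
Definition unit_continuous u :=
  forall t : R, t \in `[0, 1] -> {for t, continuous u}.

Lemma unit_continuous_within u : unit_continuous u ->
  {within `[0, 1], continuous u}.
Proof.
move=> cu; apply: continuous_in_subspaceT => t; rewrite inE; exact: cu.
Qed.

Lemma unit_integrable u : unit_continuous u ->
  (@lebesgue_measure R).-integrable `[0, 1] (EFin \o u).
Proof.
move=> cu; apply: continuous_compact_integrable; first exact: segment_compact.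
exact: unit_continuous_within.
Qed.

Lemma unit_intB u v : unit_continuous u -> unit_continuous v ->
  unit_int (u - v) = unit_int u - unit_int v.
Proof.
by move=> cu cv; rewrite /unit_int -RintegralB //; exact: unit_integrable.
Qed.

Lemma unit_intZ (k : R) u : unit_continuous u ->
  unit_int (fun t => k * u t) = k * unit_int u.
Proof. by move=> cu; rewrite /unit_int RintegralZl //; exact: unit_integrable. Qed.

Lemma unit_int_norm_le u (e : R) : unit_continuous u ->
  (forall t : R, t \in `[0, 1] -> `|u t| <= e) -> `|unit_int u| <= e.
Proof.
move=> cu ue; apply: le_trans (le_normr_Rintegral _ (unit_integrable cu)) _ => //.
apply: (@le_trans _ _ (Rintegral (@lebesgue_measure R) `[0, 1] (cst e))).
  apply: le_Rintegral => //.
  - apply: (@unit_integrable (fun t => `|u t|)) => t t01.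
    exact: (continuous_comp (cu t t01) (@norm_continuous _ _ _)).
  - by apply: unit_integrable => t _; exact: cvg_cst.
rewrite Rintegral_cst //.
have := @lebesgue_measure_itv R `[0%R, 1%R].
rewrite /= lte_fin ltr01 oppr0 adde0 => mE.
by rewrite mE mulr1.
Qed.

Lemma unit_int_derive u v :
  (forall t : R, t \in `[0, 1] -> is_derive t 1 u (v t)) -> unit_continuous v ->
  unit_int v = u 1 - u 0.
Proof.
move=> duv cv; rewrite /unit_int /Rintegral (@continuous_FTC2 _ _ u) //.
- exact: unit_continuous_within.
- have cu (t : R) : t \in `[0, 1] -> u @ t --> u t.
    by move=> /duv[dr _]; apply/differentiable_continuous/derivable1_diffP.
  split=> [t /subset_itv_oo_cc/duv[]//||].
    by apply/cvg_at_right_filter/cu; rewrite in_itv /= lexx ler01.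
  by apply/cvg_at_left_filter/cu; rewrite in_itv /= lexx ler01.
- by move=> t /subset_itv_oo_cc/duv[_]; rewrite derive1E.
Qed.

End UnitIntegral.

Section UnderUnitIntegral.
Variables (R : realType) (p : nat).
Implicit Types (H Q : 'rV[R]_p -> R -> R) (z : 'rV[R]_p).

(** Joint continuity in the parameter and the integration variable, at the points
    of {z} x [0, 1]. *)
Definition unit_jcontinuous H z :=
  forall t : R, t \in `[0, 1] -> {for (z, t), continuous (fun y => H y.1 y.2)}.

Lemma unit_jcontinuousE H z : unit_jcontinuous H z -> unit_continuous (H z).
Proof.
move=> cH t t01; have ct := cH t t01.
have cp : (fun s : R => (z, s)) @ t --> (z, t).
  exact: (cvg_pair (cvg_cst z) cvg_id).
exact: (@continuous_comp _ _ _ (fun s : R => (z, s)) (fun y => H y.1 y.2) t cp ct).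
Qed.

(** By compactness of [0, 1], continuity in the parameter is uniform in the
    integration variable. *)
Lemma unit_jcontinuous_near H z (e : R) : unit_jcontinuous H z -> 0 < e ->
  \forall y \near z, forall t : R, t \in `[0, 1] -> `|H y t - H z t| < e.
Proof.
move=> cH e0.
have /compact_near_coveringP cov := @segment_compact R 0 1.
apply: (cov _ (nbhs z) (fun y t => `|H y t - H z t| < e)) => t t01.
have e20 : 0 < e / 2 by rewrite divr_gt0.
have /cvgrPdist_lt/(_ _ e20) := cH t t01.
move=> [[A B] /= [Az Bt] AB].
exists (B, A) => //= -[s y] /= [Bs Ay].
have h1 := AB (y, s) (conj Ay Bs).
have h2 := AB (z, s) (conj (nbhs_singleton Az) Bs).
move: h1 h2 => /=; rewrite !ltr_norml => /andP[? ?] /andP[? ?].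
by apply/andP; split; lra.
Qed.

Lemma unit_int_continuous H z : (\forall y \near z, unit_continuous (H y)) ->
  unit_jcontinuous H z -> {for z, continuous (fun y => unit_int (H y))}.
Proof.
move=> cH jH.
apply/(@cvgrPdist_le _ _ _ (nbhs z) (nbhs_filter z)) => e e0.
apply: (@filterS2 _ (nbhs z) (nbhs_filter z) _ _ _ _ cH
  (unit_jcontinuous_near jH e0)) => y cy uy.
have cz := unit_jcontinuousE jH.
rewrite -unit_intB //; apply: unit_int_norm_le.
  by move=> t t01; apply: cvgB; [exact: cz | exact: cy].
by move=> t t01; rewrite -[_ t]/(H z t - H y t) distrC ltW // uy.
Qed.

(** Differentiation under the integral sign, along v: by the mean value theorem a
    difference quotient of H at z is a value of Q at a point near z, hence
    uniformly close to Q z. *)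
Lemma unit_int_is_derive H Q z v :
  (\forall y \near z, forall t : R, t \in `[0, 1] -> is_derive y v (H ^~ t) (Q y t)) ->
  (\forall y \near z, unit_continuous (H y)) ->
  unit_jcontinuous Q z ->
  is_derive z v (fun y => unit_int (H y)) (unit_int (Q z)).
Proof.
move=> dH cH jQ.
suff cvgG : (fun h : R => h^-1 *: (((fun y => unit_int (H y)) \o shift z) (h *: v) -
    unit_int (H z))) @ 0^' --> unit_int (Q z).
  by split; [apply/cvg_ex; exists (unit_int (Q z)) | exact: cvg_lim cvgG].
apply/cvgrPdist_le => e e0.
have cQz := unit_jcontinuousE jQ.
have cHz : unit_continuous (H z) by exact: nbhs_singleton cH.
have cl : {for (0 : R), continuous (fun r : R => z + r *: v)}.
  apply: cvgD; first exact: cvg_cst.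
  exact: scalel_continuous.
have goodz : \forall y \near z, [/\ unit_continuous (H y),
   (forall t : R, t \in `[0, 1] -> is_derive y v (H ^~ t) (Q y t)) &
   forall t : R, t \in `[0, 1] -> `|Q y t - Q z t| < e].
  by apply: (@filterS3 _ (nbhs z) (nbhs_filter z) _ _ _ _ _ cH dH
    (unit_jcontinuous_near jQ e0)).
have : \forall r \near (0 : R), [/\ unit_continuous (H (z + r *: v)),
   (forall t : R, t \in `[0, 1] -> is_derive (z + r *: v) v (H ^~ t) (Q (z + r *: v) t)) &
   forall t : R, t \in `[0, 1] -> `|Q (z + r *: v) t - Q z t| < e].
  have := @cl; rewrite /prop_for /continuous_at scale0r addr0.
  by move=> /(_ _ goodz).
move=> /nbhs_ballP[d /= d0 good]; exists d => //= h hd h0.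
have goodh r : `|r| <= `|h| -> [/\ unit_continuous (H (z + r *: v)),
   (forall t : R, t \in `[0, 1] -> is_derive (z + r *: v) v (H ^~ t) (Q (z + r *: v) t)) &
   forall t : R, t \in `[0, 1] -> `|Q (z + r *: v) t - Q z t| < e].
  move=> rh; apply: good; rewrite /ball /= sub0r normrN (le_lt_trans rh) //.
  by move: hd; rewrite /= sub0r normrN.
have [ch _ _] := goodh h (lexx _).
rewrite /= [h *: v + z]addrC -unit_intB // -[_ *: _]/(_ * _) -unit_intZ; last first.
  by move=> t t01; apply: cvgB; [exact: ch | exact: cHz].
have cq : unit_continuous (fun t => h^-1 * (H (z + h *: v) - H z) t).
  move=> t t01; apply: cvgM; first exact: cvg_cst.
  by apply: cvgB; [exact: ch | exact: cHz].
rewrite -unit_intB //; apply: unit_int_norm_le.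
  by move=> t t01; apply: cvgB; [exact: cQz | exact: cq].
move=> t t01.
have [r rh E] := @MVT_line R p (H ^~ t) z v h
   (fun r rh => @ex_derive _ _ _ _ _ _ _ (let: And3 _ d _ := goodh r rh in d t t01)).
have [_ dr er] := goodh r rh.
rewrite -[(_ - _) t]/(Q z t - h^-1 * (H (z + h *: v) t - H z t)) E mulKf //.
by rewrite (@derive_val _ _ _ _ _ _ _ (dr t t01)) distrC ltW // er.
Qed.

End UnderUnitIntegral.

(** * Inverses of smooth functions and the Hadamard lemma *)

Section SmoothInverse.
Variables (R : realType) (p : nat) (A : set 'rV[R]_p) (oA : open A).

(** The quotients u / k with u and k smooth and k nowhere 0 are closed under partial
    derivatives, by the quotient rule. *)
Lemma smooth_onV (h : 'rV[R]_p -> R) : smooth_on A h ->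
  (forall x, A x -> h x != 0) -> smooth_on A (fun x => (h x)^-1).
Proof.
move=> sh h0.
pose quot (f : 'rV[R]_p -> R) := exists u k, [/\ smooth_on A u, smooth_on A k,
  (forall x, A x -> k x != 0) & f = u * (fun x => (k x)^-1)].
suff : quot (fun x => (h x)^-1).
  apply: smooth_on_ind => // _ [u [k [su sk k0 ->]]].
  split=> [x Ax|i].
    have [[cu du] [ck dk]] := (su [::] x Ax, sk [::] x Ax).
    split=> [|i].
      apply: (@continuousM _ _ u (fun x => (k x)^-1)) => //.
      by apply: (@cvgV _ _ (nbhs x) (nbhs_filter x)) => //; exact: k0.
    by apply: derivableM => //; apply: derivableV => //; exact: k0.
  pose D (f : 'rV[R]_p -> R) := 'D_(delta_mx 0 i) f.
  exists ((D u * k - u * D k) * (fun x => ((k * k) x)^-1)).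
    exists (D u * k + cst (-1) * (u * D k)), (k * k); split.
    - apply: (smooth_onD oA); apply: (smooth_onM oA); last 1 first.
      + exact: (smooth_onM oA su (smooth_on_partial i sk)).
      + exact: (smooth_on_partial i su).
      + exact: sk.
      + exact: smooth_on_cst.
    - exact: (smooth_onM oA sk sk).
    - by move=> x Ax; rewrite fctE mulf_neq0 ?k0.
    - by apply/funext => x; rewrite !fctE mulN1r.
  move=> x; rewrite inE => Ax.
  have [[cu du] [ck dk]] := (su [::] x Ax, sk [::] x Ax).
  rewrite deriveM //; last by apply: derivableV => //; exact: k0.
  rewrite deriveV ?k0 // /D !fctE -[_ *: (_ *: _)]/(_ * (_ * _)) -[_ *: _]/(_ * _).
  by field; rewrite k0.
exists (cst 1), h; split; [exact: smooth_on_cst | exact: sh | exact: h0 |].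
by apply/funext => x; rewrite fctE mul1r.
Qed.

End SmoothInverse.

Section Hadamard.
Variables (R : realType) (p : nat) (y : 'rV[R]_p).
Implicit Types (c : 'I_p -> R) (z : 'rV[R]_p) (f h : 'rV[R]_p -> R).

(** The image of z under the homothety of centre y and ratio c j along the j-th
    axis. *)
Definition rescale c z : 'rV[R]_p := \row_j (y 0 j + c j * (z 0 j - y 0 j)).

Lemma rescale_line c z (j : 'I_p) (r : R) :
  rescale c (z + r *: delta_mx 0 j) =
  rescale c z + r *: (c j *: delta_mx 0 j).
Proof.
apply/rowP => i; rewrite !mxE eqxx /=; case: eqVneq => [->|_];
  rewrite ?mulr1n ?mulr0n; ring.
Qed.

Lemma rescale_ball c z (e : R) : (forall j, 0 <= c j <= 1) ->
  ball y e z -> ball y e (rescale c z).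
Proof.
move=> c01 [e0 yz]; split => // i j; rewrite ord1 /ball /= mxE.
have /andP[c0 c1] := c01 j.
rewrite opprD addNKr normrN normrM distrC; apply: le_lt_trans (yz 0 j).
by rewrite ger0_norm // ler_piMl.
Qed.

Lemma rescale_jcontinuous (c : 'I_p -> R -> R) z (t : R) :
  (forall j, {for t, continuous (c j)}) ->
  {for (z, t), continuous (fun x : 'rV[R]_p * R => rescale (c^~ x.2) x.1)}.
Proof.
move=> cc A [P Pz PA].
have ci (j : 'I_p) : (fun x : 'rV[R]_p * R => y 0 j + c j x.2 * (x.1 0 j - y 0 j))
    @ (z, t) --> y 0 j + c j t * (z 0 j - y 0 j).
  apply: cvgD; first exact: cvg_cst.
  apply: cvgM.
    exact: (@continuous_comp _ _ _ snd (c j) (z, t) (@cvg_snd _ _ _ _ _) (cc j)).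
  apply: cvgB; last exact: cvg_cst.
  exact: (@continuous_comp _ _ _ fst (fun x : 'rV[R]_p => x 0 j) (z, t)
    (@cvg_fst _ _ _ _ _) (@coord_continuous _ _ _ _ _ _)).
have : nbhs (z, t) (fun x : 'rV[R]_p * R =>
    forall j : 'I_p, P 0 j (y 0 j + c j x.2 * (x.1 0 j - y 0 j))).
  apply: (@filter_forall _ _ (fun j (x : 'rV[R]_p * R) =>
    P 0 j (y 0 j + c j x.2 * (x.1 0 j - y 0 j))) (nbhs (z, t))) => j.
  by apply: (ci j (P 0 j)); have := Pz 0 j; rewrite mxE.
apply: filterS => x Px; apply: PA => i j; rewrite ord1 mxE; exact: Px.
Qed.

Variable e : R.
Let B := ball y e.

Let oB : open B. Proof. exact: ball_open. Qed.

(** The functions of this form, for c fixed, are closed under partial derivatives: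
    differentiating in the j-th direction replaces h with its partial derivative
    and w with w * c j. *)
Lemma smooth_rescaled_int (h : 'rV[R]_p -> R) (w : R -> R) (c : 'I_p -> R -> R) :
  smooth_on B h -> continuous w -> (forall j, continuous (c j)) ->
  (forall j (t : R), t \in `[0, 1] -> 0 <= c j t <= 1) ->
  smooth_on B (fun z => unit_int (fun t => w t * h (rescale (c^~ t) z))).
Proof.
move=> sh cw cc c01.
pose H k v (z : 'rV[R]_p) (t : R) := v t * k (rescale (c^~ t) z) : R.
have BH z t : t \in `[0, 1] -> B z -> B (rescale (c^~ t) z).
  by move=> t01; apply: rescale_ball => j; exact: c01.
have jH k v z : smooth_on B k -> continuous v -> B z -> unit_jcontinuous (H k v) z.
  move=> sk cv Bz t t01; apply: cvgM.
    exact: (@continuous_comp _ _ _ snd v (z, t) (@cvg_snd _ _ _ _ _) (cv t)).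
  have [ck _] := sk [::] _ (BH _ _ t01 Bz).
  apply: (@continuous_comp _ _ _
    (fun x : 'rV[R]_p * R => rescale (c^~ x.2) x.1) k (z, t)) => //.
  by apply: rescale_jcontinuous => j; exact: cc.
have cH k v z : smooth_on B k -> continuous v -> B z ->
    \forall x \near z, unit_continuous (H k v x).
  move=> sk cv Bz; apply: filterS (open_nbhs_nbhs (conj oB Bz)) => x Bx.
  by apply: unit_jcontinuousE; exact: jH.
pose P f := exists k v, [/\ smooth_on B k, continuous v & f = fun z => unit_int (H k v z)].
suff : P (fun z => unit_int (H h w z)).
  apply: smooth_on_ind => // _ [k [v [sk cv ->]]].
  have cvj j : continuous (fun t => v t * c j t).
    by move=> t; apply: cvgM; [exact: cv | exact: cc].
  have dj (z : 'rV[R]_p) (j : 'I_p) : B z ->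
      is_derive z (delta_mx 0 j) (fun z => unit_int (H k v z))
    (unit_int (H ('D_(delta_mx 0 j) k) (fun t => v t * c j t) z)).
    move=> Bz; apply: unit_int_is_derive; first last.
    - exact: (jH _ _ _ (smooth_on_partial j sk) (cvj j) Bz).
    - exact: cH.
    apply: filterS (open_nbhs_nbhs (conj oB Bz)) => x Bx t t01.
    have [_ dk] := sk [::] _ (BH _ _ t01 Bx).
    rewrite /H -mulrA.
    apply: (@is_deriveZ _ _ _ (fun x => k (rescale (c^~ t) x)) (v t)).
    apply: derive_line.
    under [X in is_derive _ _ X]eq_fun do rewrite rescale_line.
    apply: line_derive; rewrite scale0r addr0; apply: is_derive_scale.
    exact/derivableP.
  split=> [z Bz|j].
    split; first by apply: unit_int_continuous; [exact: cH | exact: jH].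
    by move=> j; have [] := dj z j Bz.
  exists (fun z => unit_int (H ('D_(delta_mx 0 j) k) (fun t => v t * c j t) z)).
    exists ('D_(delta_mx 0 j) k), (fun t => v t * c j t).
    by split; [exact: smooth_on_partial | exact: cvj |].
  by move=> z; rewrite inE => /(dj z j)[].
by exists h, w.
Qed.

(** The Hadamard lemma on a ball around y.  The coordinates of z are moved to those
    of y one at a time, so that only the fundamental theorem of calculus in one
    variable is needed. *)
Lemma hadamard f : smooth_on B f ->
  exists2 g : 'I_p -> 'rV[R]_p -> R, (forall i, smooth_on B (g i)) &
    forall z, B z -> f z = f y + \sum_i (z 0 i - y 0 i) * g i z.
Proof.
move=> sf.
(* In step m the coordinates before m already are those of y, those after m still
   are those of z, and the m-th one goes from y to z as t goes from 0 to 1. *)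
pose c (m : 'I_p) (j : 'I_p) (t : R) : R :=
  if (j < m)%N then 0 else if j == m then t else 1.
have cc m j : continuous (c m j).
  move=> t; rewrite /c; case: (j < m)%N; first exact: cvg_cst.
  by case: (j == m); [by move=> ? | exact: cvg_cst].
have c01 m j (t : R) : t \in `[0, 1] -> 0 <= c m j t <= 1.
  rewrite in_itv /= /c => t01; case: ifP => _; first by rewrite lexx ler01.
  by case: ifP => _ //; rewrite lexx ler01.
pose d m : 'rV[R]_p := delta_mx 0 m.
exists (fun m z => unit_int (fun t => 1 * 'D_(d m) f (rescale ((c m)^~ t) z))).
  move=> m; apply: (@smooth_rescaled_int ('D_(d m) f) (cst 1) (c m)) => //.
  - exact: smooth_on_partial.
  - by move=> t; exact: cvg_cst.
  - by move=> j; exact: c01.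
move=> z Bz.
pose P k := rescale (fun j : 'I_p => ((k <= j)%N)%:R) z.
have P0 : P 0%N = z by apply/rowP => j; rewrite !mxE leq0n mulr1n; ring.
have Pp : P p = y by apply/rowP => j; rewrite !mxE leqNgt ltn_ord mulr0n; ring.
suff step (m : 'I_p) : (z 0 m - y 0 m) *
    unit_int (fun t => 1 * 'D_(d m) f (rescale ((c m)^~ t) z)) = f (P m) - f (P m.+1).
  rewrite (eq_bigr _ (fun m _ => step m)).
  (* The sum of the steps telescopes from P 0 = z to P p = y. *)
  rewrite -(big_mkord xpredT (fun k => f (P k) - f (P k.+1))).
  rewrite (eq_bigr (fun k => - f (P k.+1) - - f (P k))); last by move=> k _; ring.
  by rewrite (telescope_sumr (fun k => - f (P k))) // P0 Pp; ring.
have cz t : rescale ((c m)^~ t) z = P m.+1 + t *: ((z 0 m - y 0 m) *: d m).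
  apply/rowP => j; rewrite !mxE /c eqxx /= -!val_eqE /=.
  by case: ltngtP => [_|_|/val_inj ->] /=; rewrite ?mulr1n ?mulr0n; ring.
have BP (t : R) : t \in `[0, 1] -> B (rescale ((c m)^~ t) z).
  by move=> t01; apply: rescale_ball => // j; exact: c01.
have cf : unit_continuous (fun t => 1 * 'D_(d m) f (rescale ((c m)^~ t) z)).
  move=> t t01; have [cDf _] := smooth_on_partial m sf [::] (BP t t01).
  apply: cvgM; first exact: cvg_cst.
  apply: (@continuous_comp _ _ _ (fun t => rescale ((c m)^~ t) z) ('D_(d m) f)) => //.
  rewrite (funext cz); apply: cvgD; first exact: cvg_cst.
  exact: scalel_continuous.
rewrite -unit_intZ //.
have df (t : R) : t \in `[0, 1] -> is_derive t 1 (fun t => f (rescale ((c m)^~ t) z))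
    ((z 0 m - y 0 m) * (1 * 'D_(d m) f (rescale ((c m)^~ t) z))).
  move=> t01; rewrite mul1r.
  rewrite [X in is_derive _ _ X](_ : _ = f \o
    (fun t => P m.+1 + t *: ((z 0 m - y 0 m) *: d m)));
    last by apply/funext => s /=; rewrite cz.
  apply: line_derive; rewrite -cz; apply: is_derive_scale.
  by apply/derivableP; have [_] := sf [::] _ (BP t t01).
rewrite (unit_int_derive df); last first.
  by move=> t t01; apply: cvgM; [exact: cvg_cst | exact: cf].
by congr (f _ - f _); apply/rowP => j; rewrite !mxE /c -!val_eqE /=; case: ltngtP.
Qed.

End Hadamard.

(** * The algebra of graded power series *)

Section SeriesAlgebra.
Variables (n : nat) (X : finType) (deg : X -> 'rV['F_2]_n) (A : comPzRingType).
Notation midx := {ffun X -> nat}.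
Implicit Types (a b c : midx) (f g h : pseries deg A) (u v : A) (x : X).

Lemma coef_constM u f c : (series_const deg u * f) c = u * f c.
Proof.
rewrite Defs.coefM; case: ifP => [ok|/negbT ok]; last by rewrite coef_ok// mulr0.
rewrite (@splits_0l _ _ c (fun a b =>
  ksign A (reorder deg a b) * (series_const deg u a * f b))).
  by rewrite reorder0l /= midx_ok0 eqxx ksign0 mul1r.
by move=> a b /negPf a0; rewrite /= a0 if_same mul0r mulr0.
Qed.

Lemma series_constB u v :
  series_const deg (u - v) = series_const deg u - series_const deg v.
Proof.
apply: pseriesP => c; rewrite Defs.coefB /=.
by case: ifP => _; [case: ifP => _ |]; rewrite ?subr0.
Qed.

HB.instance Definition _ := GRing.isZmodMorphism.Build A (pseries deg A)
  (series_const (A := A) deg) series_constB.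

Lemma series_constM u v :
  series_const deg (u * v) = series_const deg u * series_const deg v.
Proof.
apply: pseriesP => c; rewrite coef_constM /=.
by case: ifP => _; [case: ifP => _ |]; rewrite ?mulr0.
Qed.

Lemma series_coef0M f g : (f * g) 0 = f 0 * g 0.
Proof.
rewrite Defs.coefM midx_ok0 (bigD1_seq (0, 0)) ?splits_uniq ?mem_splits ?addr0 //=.
rewrite reorder0l ksign0 mul1r big_seq_cond big1 ?addr0 // => -[a b].
rewrite mem_splits => /andP[/eqP/ffunP ab0 /eqP[]]; congr pair; apply/ffunP => x;
  have := ab0 x; rewrite !ffunE; case: (a x) (b x) => [|k] [|l] //.
Qed.

(** Some variable that occurs in the monomial of exponent a, if any. *)
Definition first_var a : option X := [pick x | (0 < a x)%N].

Lemma first_varP a : a != 0 -> exists2 x, first_var a = Some x & (0 < a x)%N.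
Proof.
move=> a0; rewrite /first_var; case: pickP => [x ax|ax]; first by exists x.
case/eqP: a0; apply/ffunP => x; rewrite ffunE.
by apply/eqP; rewrite -leqn0 leqNgt ax.
Qed.

(** The quotient by xi_x of the part of f made of the monomials whose chosen
    variable is x.  The sign compensates for the one of the product of xi_x and
    xi^b. *)
Definition series_quot f x : pseries deg A := to_series deg (fun b =>
  if first_var (b + midx_unit x) == Some x then
    ksign A (reorder deg (midx_unit x) b) * f (b + midx_unit x) else 0).

Lemma series_gen_quot f x c : (series_gen deg A x * series_quot f x) c =
  if first_var c == Some x then f c else 0.
Proof.
rewrite Defs.coefM; case: (boolP (midx_ok deg c)) => ok; last by rewrite coef_ok ?if_same.
have [cx|cx] := posnP (c x).
  rewrite big_seq_cond big1 => [|[a b]]; last first.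
    rewrite mem_splits andbT => /eqP abc /=; case: (a =P midx_unit x) => [ax|_].
      by move: cx; rewrite -abc ax !ffunE eqxx.
    by rewrite if_same mul0r mulr0.
  rewrite /first_var; case: pickP => // y cy; case: eqP => // -[yx].
  by move: cy; rewrite yx cx.
pose b := [ffun y => c y - midx_unit x y]%N.
have bE : b + midx_unit x = c.
  by apply/ffunP => y; rewrite !ffunE; apply: subnK; case: eqP => // ->.
rewrite (bigD1_seq (midx_unit x, b)) ?splits_uniq ?mem_splits 1?addrC ?bE //=.
rewrite big_seq_cond big1 => [|[a b']]; last first.
  rewrite mem_splits => /andP[/eqP abc ne] /=; case: (a =P midx_unit x) => [ax|_].
    case/eqP: ne; congr pair => //; apply: (@midx_addIr _ (midx_unit x)).
    by rewrite bE -abc ax addrC.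
  by rewrite if_same mul0r mulr0.
rewrite addr0 midx_ok_unit eqxx mul1r.
rewrite (midx_okl (b := midx_unit x)) bE //.
by case: ifP => _; rewrite ?mulr0 // mulrA -ksignD addF2 mul1r.
Qed.

(** Each nonconstant monomial is assigned to one of its variables and divided by
    it. *)
Lemma series_decomp f :
  f = series_const deg (f 0) + \sum_x series_gen deg A x * series_quot f x.
Proof.
apply: pseriesP => c; rewrite Defs.coefD.
have coef_sum (F : X -> pseries deg A) : (\sum_x F x) c = \sum_x F x c.
  by apply: (big_morph (fun f => coef f c) (id1 := 0) (op1 := +%R)).
rewrite coef_sum (eq_bigr _ (fun x _ => series_gen_quot f x c)).
have [->|c0] := eqVneq c 0.
  rewrite /= midx_ok0 eqxx big1 ?addr0 // => x _; rewrite /first_var.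
  by case: pickP => // y; rewrite ffunE.
have [x cx _] := first_varP c0; rewrite cx /= (negPf c0) if_same add0r.
rewrite (bigD1 x) //= eqxx big1 ?addr0 // => y yx.
by case: eqP => // -[xy]; rewrite xy eqxx in yx.
Qed.

Lemma series_gen_partial_homogeneous x d f : homogeneous d f ->
  homogeneous (deg x + d) (series_gen_partial x f).
Proof.
move=> df a ad /=; rewrite df ?mulr0 ?mul0rn // => adx; apply: ad.
have midx_degD b c : midx_deg deg (b + c) = midx_deg deg b + midx_deg deg c.
  by rewrite -big_split; apply: eq_bigr => y _; rewrite ffunE mulrnDr.
have xx : deg x + deg x = 0 by apply/rowP => k; rewrite !mxE addF2.
have ux : midx_deg deg (midx_unit x) = deg x.
  rewrite /midx_deg (bigD1 x)//= big1 ?addr0 => [|y /negPf yx].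
    by rewrite ffunE eqxx.
  by rewrite ffunE yx.
by rewrite -adx midx_degD ux addrCA xx addr0.
Qed.

Lemma series_gen_partialB x f g :
  series_gen_partial x (f - g) = series_gen_partial x f - series_gen_partial x g.
Proof. by apply: pseriesP => c; rewrite !Defs.coefB /= mulrBr mulrnBl. Qed.

Lemma homogeneousB d f g : homogeneous d f -> homogeneous d g -> homogeneous d (f - g).
Proof. by move=> df dg a ad; rewrite Defs.coefB df // dg // subr0. Qed.

End SeriesAlgebra.

Lemma series_mapB (n : nat) (X : finType) (deg : X -> 'rV['F_2]_n)
    (A B : zmodType) (h : {additive A -> B}) (f g : pseries deg A) :
  series_map h (f - g) = series_map h f - series_map h g.
Proof. by apply: pseriesP => c; rewrite !Defs.coefB /= raddfB. Qed.

Lemma series_map_morphM (n : nat) (X : finType) (deg : X -> 'rV['F_2]_n)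
    (A B : comPzRingType) (h : {additive A -> B}) :
  {morph h : u v / u * v} ->
  {morph (series_map h : pseries deg A -> pseries deg B) : f g / f * g}.
Proof.
move=> hM f g; apply: pseriesP => c; rewrite Defs.coefM -[LHS]/(h ((f * g) c)) Defs.coefM.
case: ifP => _; last by rewrite raddf0.
rewrite raddf_sum; apply: eq_bigr => s _ /=; rewrite -hM.
by case: (F2P (reorder deg s.1 s.2)) => ->;
  rewrite ?ksign0 ?ksign1 ?mul1r ?mulN1r ?raddfN.
Qed.

Lemma series_constZ (R : realType) (n p : nat) (X : finType)
    (deg : X -> 'rV['F_2]_n) (W : opens 'rV[R]_p) (k : R) (u : smooth_fun W) :
  series_const deg (k *: u) = k *: series_const deg u.
Proof.
apply: pseriesP => c; rewrite -[RHS]/(k *: coef (series_const deg u) c) /=.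
by case: ifP => _; [case: ifP => _ |]; rewrite ?scaler0.
Qed.

(** * Sections, their derivatives and their orders of vanishing *)

Section SmoothPoint.
Variables (R : realType) (p : nat).

Lemma smooth_oneE (W : opens 'rV[R]_p) x : oset W x -> (1 : smooth_fun W) x = 1.
Proof. exact: to_smoothE. Qed.

Lemma smooth_partial_const (W : opens 'rV[R]_p) i (k : R) :
  smooth_partial i (k *: (1 : smooth_fun W)) = 0.
Proof.
apply: smooth_funP; apply/funext => x.
have [Wx|Wx] := pselect (oset W x); last by rewrite !smooth_val_out.
rewrite to_smoothE //.
rewrite (@near_eq_derive _ _ _ _ (cst k)) ?derive_cst //.
apply: (open_near_eq (oset_open W)) => // z; rewrite inE => Wz.
by rewrite -[LHS]/(k * (1 : smooth_fun W) z) smooth_oneE // mulr1.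
Qed.

Variables (W W' : opens 'rV[R]_p) (sW : W' `<=` W).

Lemma smooth_resM : {morph smooth_res sW : u v / u * v}.
Proof.
move=> u v; apply: smooth_funP; apply/funext => x.
have [Wx|Wx] := pselect (oset W' x); last by rewrite !smooth_val_out.
by rewrite smooth_resE // -[LHS]/(u x * v x) -[RHS]/(_ * _) !smooth_resE.
Qed.

Lemma smooth_res1 : smooth_res sW 1 = 1.
Proof.
apply: smooth_funP; apply/funext => x.
have [Wx|Wx] := pselect (oset W' x); last by rewrite !smooth_val_out.
by rewrite smooth_resE // !smooth_oneE //; exact: sW.
Qed.

Lemma smooth_res_coord i :
  smooth_res sW (smooth_coord W i) = smooth_coord W' i.
Proof.
apply: smooth_funP; apply/funext => x.
have [Wx|Wx] := pselect (oset W' x); last by rewrite !smooth_val_out.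
by rewrite smooth_resE // !to_smoothE //; exact: sW.
Qed.

Lemma smooth_res_partial i u :
  smooth_res sW (smooth_partial i u) = smooth_partial i (smooth_res sW u).
Proof.
apply: smooth_funP; apply/funext => x.
have [Wx|Wx] := pselect (oset W' x); last by rewrite !smooth_val_out.
rewrite smooth_resE // !to_smoothE //; last exact: sW.
apply: near_eq_derive.
apply: (open_near_eq (oset_open W')) => // z; rewrite inE => Wz.
by rewrite smooth_resE.
Qed.

End SmoothPoint.

Section Sheaf.
Variables (R : realType) (n : nat) (gamma : nonzero_order n).
Variable U : superdomain R n.
Implicit Types (W : opens 'rV[R]_(dim0 U)) (a b : coord_index U).

Local Notation sheaf W := (@sheaf R n gamma U W).
Local Notation coord_deg := (@coord_deg R n gamma U).

Lemma pdB W a (f g : sheaf W) : pd a (f - g) = pd a f - pd a g.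
Proof. by case: a => [i|x]; [exact: series_mapB | exact: series_gen_partialB]. Qed.

HB.instance Definition _ W a := GRing.isZmodMorphism.Build (sheaf W) (sheaf W)
  (@pd R n gamma U W a) (@pdB W a).

Lemma pd_const W a (k : R) : pd a (k *: (1 : sheaf W)) = 0.
Proof.
apply: pseriesP => c; case: a => [i|x].
  rewrite -[LHS]/(smooth_partial i (k *: coef (1 : sheaf W) c)).
  rewrite -[coef _ c]/(if midx_ok _ c then if c == 0 then 1 else 0 else 0).
  case: ifP => _; last by rewrite scaler0 raddf0.
  by case: ifP => _; rewrite ?smooth_partial_const // scaler0 raddf0.
rewrite -[LHS]/(ksign _ _ * (k *: coef (1 : sheaf W) (c + midx_unit x)) *+ (c x).+1).
rewrite -[coef _ _]/(if midx_ok _ (c + midx_unit x)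
  then if c + midx_unit x == 0 then 1 else 0 else 0).
case: (c + _ =P _) => [/ffunP/(_ x)|_]; first by rewrite !ffunE eqxx addrC.
by rewrite if_same scaler0 mulr0 mul0rn.
Qed.

Lemma pd_homogeneous W a d (f : sheaf W) :
  homogeneous d f -> homogeneous (coord_deg a + d) (pd a f).
Proof.
case: a => [i|x] df; last exact: series_gen_partial_homogeneous.
by rewrite add0r => c cd; rewrite /= df // raddf0.
Qed.

Lemma coef_res W W' (sW : W' `<=` W) (f : sheaf W) c x : oset W' x ->
  coef (sheaf_res sW f) c x = coef f c x.
Proof. exact: smooth_resE. Qed.

Lemma sheaf_resB W W' (sW : W' `<=` W) (f g : sheaf W) :
  sheaf_res sW (f - g) = sheaf_res sW f - sheaf_res sW g.
Proof. exact: series_mapB. Qed.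

HB.instance Definition _ W W' (sW : W' `<=` W) :=
  GRing.isZmodMorphism.Build (sheaf W) (sheaf W')
  (@sheaf_res R n gamma U W W' sW) (@sheaf_resB W W' sW).

Lemma sheaf_resM W W' (sW : W' `<=` W) (f g : sheaf W) :
  sheaf_res sW (f * g) = sheaf_res sW f * sheaf_res sW g.
Proof. exact: (series_map_morphM (smooth_resM sW)). Qed.

Lemma sheaf_res_pd W W' (sW : W' `<=` W) a (f : sheaf W) :
  sheaf_res sW (pd a f) = pd a (sheaf_res sW f).
Proof.
apply: pseriesP => c; case: a => [i|x]; first exact: smooth_res_partial.
rewrite /= raddfMn /=; congr (_ *+ _).
by set e := dotZ2 _ _; case: (F2P e) => ->;
  rewrite ?ksign0 ?ksign1 ?mul1r ?mulN1r ?raddfN.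
Qed.

Lemma sheaf_res_coordinate W W' (sW : W' `<=` W) b :
  sheaf_res sW (coordinate gamma W b) = coordinate gamma W' b.
Proof.
apply: pseriesP => d; case: b => [i|y] /=; case: ifP => _; rewrite ?raddf0 //;
  case: ifP => _; rewrite ?raddf0 //.
- exact: smooth_res_coord.
- exact: smooth_res1.
Qed.

Section Vanishing.
Variables (W : opens 'rV[R]_(dim0 U)) (x : 'rV[R]_(dim0 U)) (Wx : oset W x).
Implicit Types (f g h : sheaf W).

(** The value at x of the coefficient of the monomial 1. *)
Definition value f : R := coef f 0 x.

Lemma valueB f g : value (f - g) = value f - value g.
Proof.
by rewrite /value Defs.coefB -[LHS]/(coef f 0 x + -1 * coef g 0 x) mulN1r.
Qed.

Lemma valueM f g : value (f * g) = value f * value g.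
Proof. by rewrite /value series_coef0M. Qed.

Lemma value1 : value 1 = 1.
Proof.
rewrite /value -[LHS]/((if midx_ok _ 0 then if 0 == 0 then 1 else 0 else 0 :
  smooth_fun W) x).
by rewrite midx_ok0 eqxx smooth_oneE.
Qed.

Lemma valueZ (k : R) f : value (k *: f) = k * value f.
Proof. by []. Qed.

(** Vanishing at x to order k, where all the coordinates, of zero and nonzero degree,
    are differentiated alike. *)
Fixpoint vanishes (k : nat) f : Prop :=
  if k is k'.+1 then value f = 0 /\ forall a, vanishes k' (pd a f) else True.

Lemma vanishesS k f : vanishes k.+1 f -> vanishes k f.
Proof.
elim: k f => [//|k IH] f [f0 df]; split => // a; exact/IH/df.
Qed.

Lemma vanishesB k f g : vanishes k f -> vanishes k g -> vanishes k (f - g).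
Proof.
elim: k f g => [//|k IH] f g [f0 df] [g0 dg]; split; first by rewrite valueB f0 g0 subr0.
by move=> a; rewrite pdB; exact: IH (df a) (dg a).
Qed.

Lemma vanishes0 k : vanishes k 0.
Proof.
by elim: k => [//|k IH]; split=> [//|a]; rewrite raddf0.
Qed.

Lemma vanishesN k f : vanishes k f -> vanishes k (- f).
Proof. by rewrite -sub0r; apply: vanishesB; exact: vanishes0. Qed.

Lemma vanishesD k f g : vanishes k f -> vanishes k g -> vanishes k (f + g).
Proof. by rewrite -[g in f + g]opprK => vf vg; exact/vanishesB/vanishesN. Qed.

Lemma vanishes_ksign k (e : 'F_2) f :
  vanishes k f -> vanishes k (ksign (sheaf W) e * f).
Proof.
case: (F2P e) => -> vf; rewrite ?ksign0 ?ksign1 ?mul1r ?mulN1r //.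
exact: vanishesN.
Qed.

(** The left factor has to be homogeneous for the graded Leibniz rule to apply; its
    degree changes in the induction. *)
Lemma vanishesM k d f g : homogeneous d f -> vanishes k g -> vanishes k (f * g).
Proof.
elim: k d f g => [//|k IH] d f g df vg; have [g0 dg] := vg.
split=> [|a]; first by rewrite valueM g0 mulr0.
rewrite (pdM _ _ df); apply: vanishesD; last first.
  by apply: vanishes_ksign; apply: IH df (dg a).
by apply: IH (pd_homogeneous df) _; exact: vanishesS.
Qed.

Lemma vanishesMS k d f g : homogeneous d f -> value f = 0 -> vanishes k g ->
  vanishes k.+1 (f * g).
Proof.
elim: k d f g => [|k IH] d f g df f0 vg;
  (split=> [|a]; first by rewrite valueM f0 mul0r) => //.
rewrite (pdM _ _ df); apply: vanishesD; first exact: vanishesM (pd_homogeneous df) vg.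
by apply: vanishes_ksign; apply: IH df f0 _; have [_] := vg; apply.
Qed.

(** Differentiating with respect to xi_y lowers the degree of a monomial, and
    multiplies it by a nonzero number. *)
Lemma vanishes_coef f : (forall k, vanishes k f) -> forall c, coef f c x = 0.
Proof.
move=> vf c.
have [m] := ubnP (\sum_y c y)%N; elim: m c f vf => [//|m IH] c f vf cm.
have [->|c0] := eqVneq c 0; first by have [] := vf 1%N.
have [y _ cy] := first_varP c0.
pose b := [ffun z => c z - midx_unit y z]%N.
have bE : b + midx_unit y = c.
  by apply/ffunP => z; rewrite !ffunE; apply: subnK; case: eqP => // ->.
have bm : (\sum_z b z < m)%N.
  rewrite -ltnS; apply: leq_ltn_trans cm.
  rewrite [ltnRHS](_ : _ = \sum_z (b z + midx_unit y z))%N; last first.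
    by rewrite -bE; apply: eq_bigr => z _; rewrite [LHS]ffunE.
  rewrite big_split /= (bigD1 y (F := midx_unit y)) //= ffunE eqxx.
  by rewrite addnCA add1n ltnS leq_addr.
have := IH b (pd (inr y : coord_index U) f) (fun k => (vf k.+1).2 (inr y)) bm.
rewrite -[coef _ b]/(ksign (smooth_fun W) (dotZ2 (xi_deg gamma y)
  (before (xi_deg gamma (U := U)) y b)) * coef f (b + midx_unit y) *+ (b y).+1) bE.
have mulrnE (u : smooth_fun W) k : (u *+ k) x = u x *+ k.
  by elim: k => [//|k IHk]; rewrite !mulrS -IHk.
rewrite mulrnE => /eqP; rewrite mulrn_eq0 => /eqP.
set e := dotZ2 _ _; case: (F2P e) => ->; rewrite ?ksign0 ?ksign1 ?mul1r ?mulN1r //.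
by rewrite -[smooth_val _ _]/(-1 * coef f c x) mulN1r => /eqP; rewrite oppr_eq0 => /eqP.
Qed.

End Vanishing.

End Sheaf.

(** * The Hadamard lemma for sections *)

Section Decomposition.
Variables (R : realType) (n : nat) (gamma : nonzero_order n).
Variable V : superdomain R n.
Implicit Types W : opens 'rV[R]_(dim0 V).

(** The value at y of a coordinate; it is 0 if the degree of the coordinate is not. *)
Definition coord_value (y : 'rV[R]_(dim0 V)) (b : coord_index V) : R :=
  if b is inl i then y 0 i else 0.

(** The coordinate b minus its value at y, again homogeneous, and of value 0 at y. *)
Definition shifted_coord W y b : sheaf gamma W :=
  coordinate gamma W b - coord_value y b *: (1 : sheaf gamma W).

Lemma shifted_coord_homogeneous W y b :
  homogeneous (coord_deg gamma b) (shifted_coord W y b).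
Proof.
apply: homogeneousB; first exact: coord_homogeneous.
case: b => [i|x] c cd; last first.
  by rewrite -[LHS]/(0 *: coef (1 : sheaf gamma W) c) scale0r.
rewrite -[LHS]/(y 0 i *: coef (1 : sheaf gamma W) c).
rewrite -[coef _ c]/(if midx_ok _ c then if c == 0 then 1 else 0 else 0).
case: eqP => [c0|_]; last by rewrite if_same scaler0.
by case: cd; rewrite c0; apply: big1 => x _; rewrite ffunE mulr0n.
Qed.

Lemma pd_shifted_coord W y a b :
  pd a (shifted_coord W y b) = if a == b then 1 else 0.
Proof. by rewrite /shifted_coord raddfB /= pd_const subr0 pd_coord. Qed.

(** The Hadamard lemma in the algebra of smooth functions on a ball. *)
Lemma smooth_fun_hadamard (y : 'rV[R]_(dim0 V)) (e : R)
    (W := Opens (ball_open y e)) (u : smooth_fun W) :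
  exists g : 'I_(dim0 V) -> smooth_fun W,
    u = u y *: (1 : smooth_fun W) +
      \sum_i (smooth_coord W i - y 0 i *: (1 : smooth_fun W)) * g i.
Proof.
have [g sg gE] := hadamard (smooth_valP u).
exists (fun i => to_smooth (W := W) (sg i)).
apply: smooth_funP; apply/funext => z.
have [Wz|Wz] := pselect (oset W z); last by rewrite !smooth_val_out.
rewrite gE // -[RHS]/(u y * (1 : smooth_fun W) z + smooth_val (\sum_i _) z).
rewrite smooth_oneE // mulr1; congr (_ + _).
rewrite (big_morph (fun v : smooth_fun W => v z) (id1 := 0) (op1 := +%R)) //.
apply: eq_bigr => i _.
rewrite -[RHS]/((smooth_coord W i z + -1 * (y 0 i * (1 : smooth_fun W) z)) *
  to_smooth (W := W) (sg i) z).
by rewrite smooth_oneE // !to_smoothE // mulr1 mulN1r.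
Qed.

Lemma sheaf_hadamard (y : 'rV[R]_(dim0 V)) (e : R)
    (W := Opens (ball_open y e)) (f : sheaf gamma W) :
  exists (k : R) (g : coord_index V -> sheaf gamma W),
    f = k *: (1 : sheaf gamma W) + \sum_b shifted_coord W y b * g b.
Proof.
have [g gE] := smooth_fun_hadamard (coef f 0).
pose K := series_const (A := smooth_fun W) (xi_deg gamma (U := V)).
have KZ (k : R) u : K (k *: u) = k *: K u := series_constZ _ k u.
exists (coef f 0 y), (fun b =>
  match b with inl i => K (g i) | inr x => series_quot f x end).
rewrite big_sumType /= addrA.
rewrite [LHS](series_decomp f); congr (_ + _); last first.
  by apply: eq_bigr => x _; rewrite /shifted_coord /= scale0r subr0.
have Kadd : zmod_morphism K by exact: series_constB.
pose Kz : {additive smooth_fun W -> sheaf gamma W} :=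
  HB.pack K (GRing.isZmodMorphism.Build _ _ K Kadd).
rewrite {1}gE -[series_const _ _]/(Kz _) raddfD raddf_sum /= KZ; congr (_ + _).
apply: eq_bigr => i _.
by rewrite -[LHS]/(K _) /K series_constM -/K Kadd KZ.
Qed.

End Decomposition.

(** * Values of pullbacks, and the chain rule *)

Section Pullback.
Variables (R : realType) (n : nat) (gamma : nonzero_order n).
Variables (U V : superdomain R n) (psi : morphism gamma U V).
Local Notation phi := (base psi).
Implicit Types W : opens 'rV[R]_(dim0 V).

(** The pullback is compatible with the map of the bodies: otherwise u - c, for c the
    value at x of the pullback of u, is nonzero at phi x, hence invertible on a
    neighbourhood W' of phi x, whereas its pullback has value 0 at x. *)
Lemma pull_const_value W (sW : W `<=` V) (x : 'rV[R]_(dim0 U)) (u : smooth_fun W) :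
  oset (Defs.preim phi W) x ->
  value x (pull psi sW (series_const (xi_deg gamma (U := V)) u)) = u (phi x).
Proof.
move=> Wx; have [Ux Wy] := Wx.
apply/eqP; rewrite -subr_eq0; apply/negPn/negP => neq.
set c := value _ _ in neq.
pose h := u - c *: (1 : smooth_fun W).
have hE z : oset W z -> h z = u z - c.
  move=> Wz; rewrite -[LHS]/(u z + -1 * (c * (1 : smooth_fun W) z)).
  by rewrite smooth_oneE // mulr1 mulN1r.
have oW' : open (W `&` [set z | h z != 0]).
  rewrite openE => z [Wz hz]; apply: filterI.
    exact: open_nbhs_nbhs (conj (oset_open W) Wz).
  have [ch _] := smooth_valP h [::] Wz.
  exact: (@cvgr_neq0 _ _ _ (nbhs z) (nbhs_filter z) h (h z) ch hz).
pose W' := Opens oW'.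
have sWW' : W' `<=` W by move=> z [].
have sW' : W' `<=` V by move=> z /sWW'/sW.
have W'x : oset (Defs.preim phi W') x.
  have hy : h (phi x) != 0 by rewrite hE // -oppr_eq0 opprB.
  by split => //; split.
have sh := smooth_onW sWW' (smooth_valP h).
have h0 z : oset W' z -> h z != 0 by case.
pose g : smooth_fun W' := to_smooth (W := W') (smooth_onV oW' sh h0).
have hg : smooth_res sWW' h * g = 1.
  apply: smooth_funP; apply/funext => z.
  have [Wz|Wz] := pselect (oset W' z); last by rewrite !smooth_val_out.
  rewrite -[LHS]/(smooth_res sWW' h z * g z) smooth_resE // to_smoothE //.
  by rewrite smooth_oneE // mulfV ?h0.
pose K := series_const (A := smooth_fun W') (xi_deg gamma (U := V)).
pose K0 := series_const (A := smooth_fun W) (xi_deg gamma (U := V)).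
have K0Z (k : R) v : K0 (k *: v) = k *: K0 v := series_constZ _ k v.
have : value x (pull psi sW' (K (smooth_res sWW' h) * K g)) = 1.
  by rewrite -series_constM hg -[series_const _ 1]/(1 : sheaf gamma W') rmorph1 value1.
rewrite rmorphM valueM.
suff -> : value x (pull psi sW' (K (smooth_res sWW' h))) = 0.
  by rewrite mul0r => /esym/eqP; rewrite oner_eq0.
have -> : K (smooth_res sWW' h) = sheaf_res sWW'
    (series_const (xi_deg gamma (U := V)) u - c *: (1 : sheaf gamma W) : sheaf gamma W).
  rewrite -[c *: (1 : sheaf gamma W)]/(c *: K0 1) -K0Z -series_constB.
  apply: pseriesP => a /=.
  by case: ifP => _; [case: ifP => _|]; rewrite ?raddf0.
rewrite pull_res /value coef_res // -/(value x _) rmorphB pull_scale rmorph1.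
by rewrite valueB valueZ value1 // mulr1 subrr.
Qed.

(** For a coordinate of nonzero degree the pullback is homogeneous of that degree,
    hence has no term of exponent 0. *)
Lemma pull_shifted_coord W (sW : W `<=` V) (x : 'rV[R]_(dim0 U)) b :
  oset (Defs.preim phi W) x ->
  value x (pull psi sW (shifted_coord gamma W (phi x) b)) = 0.
Proof.
move=> Wx; have [_ Wy] := Wx.
case: b => [i|t].
  rewrite /shifted_coord rmorphB pull_scale rmorph1 valueB valueZ value1 // mulr1.
  by rewrite pull_const_value // to_smoothE // subrr.
have hw := @shifted_coord_homogeneous _ _ gamma _ W (phi x) (inr t).
rewrite /value (@pull_deg _ _ _ _ _ psi _ sW _ _ hw) //.
rewrite /midx_deg big1 => [|s _]; last by rewrite ffunE mulr0n.
have /eqP := (nz_eltP gamma (xi_deg gamma t)).2 (ex_intro _ (tag t) erefl).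
by move=> nz /esym.
Qed.

Section ChainDefect.
Variables (W : opens 'rV[R]_(dim0 V)) (sW : W `<=` V) (a : coord_index U).

Local Notation pl := (pull psi sW).

(** The difference of the two sides of the chain rule, over an open subset W of V. *)
Definition chain_defect (f : sheaf gamma W) : sheaf gamma (Defs.preim phi W) :=
  pd a (pl f) - \sum_b pd a (pl (coordinate gamma W b)) * pl (pd b f).

Lemma chain_defectB : zmod_morphism chain_defect.
Proof.
move=> f g; rewrite /chain_defect !raddfB /=.
under eq_bigr do rewrite !raddfB /= mulrBr.
by rewrite sumrB !opprB [RHS]addrACA opprK [- _ + _ in RHS]addrC.
Qed.

HB.instance Definition _ := GRing.isZmodMorphism.Build _ _ chain_defect chain_defectB.

Lemma chain_defect_const (k : R) : chain_defect (k *: (1 : sheaf gamma W)) = 0.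
Proof.
rewrite /chain_defect pull_scale rmorph1 pd_const sub0r big1 ?oppr0 // => b _.
by rewrite pd_const rmorph0 mulr0.
Qed.

(** Both sides of the chain rule satisfy the same Leibniz rule, and they agree on w;
    only the terms with the derivatives of g are left. *)
Lemma chain_defectM y b g :
  chain_defect (shifted_coord gamma W y b * g) =
  ksign _ (dotZ2 (coord_deg gamma a) (coord_deg gamma b)) *
    (pl (shifted_coord gamma W y b) * chain_defect g).
Proof.
set w := shifted_coord _ _ _ _; set s := ksign _ _.
have hw : homogeneous (coord_deg gamma b) w by exact: shifted_coord_homogeneous.
have hpw := @pull_deg _ _ _ _ _ psi _ sW _ _ hw.
rewrite /chain_defect rmorphM (pdM _ _ hpw) -/s.
have pdw : pd a (pl (coordinate gamma W b)) = pd a (pl w).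
  by rewrite /w /shifted_coord rmorphB pull_scale rmorph1 raddfB /= pd_const subr0.
rewrite (eq_bigr (fun b' => (if b' == b then pd a (pl w) * pl g else 0) +
    s * (pl w * (pd a (pl (coordinate gamma W b')) * pl (pd b' g))))); last first.
  move=> b' _; rewrite (pdM _ _ hw) pd_shifted_coord rmorphD mulrDr; congr (_ + _).
    by case: eqP => [->|_]; rewrite ?mul1r ?pdw // mul0r rmorph0 mulr0.
  have pk e : pl (ksign _ e) = ksign _ e by rewrite /ksign rmorphXn rmorphN1.
  rewrite !rmorphM pk.
  have hD := @pd_homogeneous _ _ gamma U _ a _ _
    (@pull_deg _ _ _ _ _ psi _ sW _ _ (@coord_homogeneous _ _ gamma V W b')).
  have := series_mul_gcomm hD hpw; rewrite -/(sheaf gamma _).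
  set D := pd a _; set P := pl w; move=> comm.
  (* The derivative D of the pulled-back coordinate b' has degree deg a + deg b';
     crossing P it contributes the sign that cancels the one of d_b' crossing w. *)
  rewrite [LHS]mulrA -ksign_comm -mulrA (mulrA D P) comm !mulrA -ksignD.
  by rewrite dotZ2Dl addrC -addrA addF2 addr0.
rewrite big_split /= -big_mkcond big_pred1_eq -!mulr_sumr mulrBr mulrBr.
by rewrite opprD addrACA subrr add0r.
Qed.

End ChainDefect.

Lemma chain_defect_vanishes (x : 'rV[R]_(dim0 U)) (e : R)
    (W := Opens (ball_open (phi x) e)) (sW : W `<=` V) (a : coord_index U) k f :
  0 < e -> oset U x -> vanishes x k (chain_defect sW a f).
Proof.
move=> e0 Ux.
have Wx : oset (Defs.preim phi W) x by split => //; exact: ballxx.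
elim: k f => [//|k IH] f.
have [c [g ->]] := sheaf_hadamard f.
set v := vanishes x k.+1.
rewrite raddfD /= chain_defect_const add0r raddf_sum.
apply: (big_ind v); [exact: vanishes0 | exact: vanishesD |].
move=> b _ /=; rewrite chain_defectM /v; apply: vanishes_ksign.
apply: vanishesMS (IH _); last exact: pull_shifted_coord.
exact: (@pull_deg _ _ _ _ _ psi _ sW _ _ (@shifted_coord_homogeneous _ _ gamma _ W _ _)).
Qed.

End Pullback.

Theorem proposition2p10 (R : realType) (n : nat) (gamma : nonzero_order n)
    (U V : superdomain R n) (psi : morphism gamma U V) (f : sheaf gamma V)
    (a : coord_index U) :
  pd a (pullback psi f) =
  \sum_(b : coord_index V)
    pd a (pullback psi (coordinate gamma V b)) * pullback psi (pd b f).
Proof.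
apply/eqP; rewrite -subr_eq0; set G := (X in X == _); apply/eqP; apply: pseriesP => c.
apply: smooth_funP; apply/funext => x.
have [Ux|Ux] := pselect (oset U x); last by rewrite !smooth_val_out.
have Vy : oset V (base psi x) by exact: base_sub.
have /nbhs_ballP[e /= e0 sW] := open_nbhs_nbhs (conj (oset_open V) Vy).
pose W := Opens (ball_open (base psi x) e).
have sWV : W `<=` V by [].
have sWU : Defs.preim (base psi) W `<=` U by move=> z [].
have Wx : oset (Defs.preim (base psi) W) x by split => //; exact: ballxx.
have plE g : sheaf_res sWU (pullback psi g) = pull psi sWV (sheaf_res sWV g).
  rewrite (pull_res psi (@subset_refl _ V)).
  apply: pseriesP => d; apply: smooth_funP; apply/funext => z.
  have [Wz|Wz] := pselect (oset (Defs.preim (base psi) W) z); last first.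
    by rewrite !smooth_val_out.
  by rewrite !coef_res //; exact: sWU.
have GE : sheaf_res sWU G = chain_defect psi sWV a (sheaf_res sWV f).
  rewrite /G raddfB raddf_sum /= sheaf_res_pd plE; congr (_ - _).
  by apply: eq_bigr => b _; rewrite sheaf_resM sheaf_res_pd !plE
    sheaf_res_coordinate sheaf_res_pd.
rewrite -[LHS]/(coef G c x) -(coef_res sWU) // GE.
have van k := @chain_defect_vanishes _ _ gamma U V psi x e sWV a k (sheaf_res sWV f) e0 Ux.
exact: (vanishes_coef van c).
Qed.
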